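(* Let $k\ge 2$ be a constant. Let $T$ be a rooted tree of height $h\le k$ with $n$ vertices whose set of leaves $L$ consists of vertices all at depth $h$. Let $F$ be a bipartite graph with parts $L$ and a set $W$ (disjoint from $V(T)$) of at most $n$ vertices, and let $G=T\cup F$. Then there is an algorithm that, in time $O(e(F)\log n+n)$, computes a set $X$ of at least $e(F)/k-O(k^2(|L|+|W|))$ pairs of the form $(uv,C)$, where $uv\in E(F)$ and $C\subseteq G$ is a cycle of length $2k$ containing the edge $uv$.
   Context: $e(F)$ denotes the number of edges of $F$. The depth of a vertex in a rooted tree is its distance from the root.
   Formalization: The lower bound on |X| is claimed only for h < k; for h = k it is false (k = h = 2, T a spider with legs of length 2, F a dense graph without 4-cycles). The algorithm, its running time and the validity of the pairs are kept for all h ≤ k. *)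

(* Defs.v *)
From mathcomp Require Import all_boot all_order all_algebra.

Set Implicit Arguments.
Unset Strict Implicit.
Unset Printing Implicit Defensive.

(** * Graphs: a simple graph on [V] is a symmetric irreflexive [e : rel V] *)

Section Graphs.
Variable V : finType.
Implicit Types (e : rel V) (r v : V) (c : seq V).

Definition tree e : Prop :=
  [/\ symmetric e, irreflexive e, (forall x y, connect e x y) &
      forall c, 2 < size c -> ~ ucycle e c].

Definition walk e x y d : bool :=
  [exists p : d.-tuple V, path e x p && (last x p == y)].

(* Length of a shortest walk; it is [#|V|] if there is none. *)
Definition dist e x y : nat := find (walk e x y) (iota 0 #|V|).

Definition height e r : nat := \max_v dist e r v.

(* A leaf is a vertex without children, so the root of a one-vertex tree is a
   leaf, but a root of degree one is not. *)
Definition leaves e r : {set V} :=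
  [set v | [forall u, e v u ==> (dist e r u < dist e r v)]].

(* The root is its own parent. *)
Definition parent e r v : V :=
  odflt v [pick u | e v u && (dist e r u < dist e r v)].

(* A cycle is a subgraph, hence it is identified with its set of edges;
   rotating or reversing the sequence [c] gives the same cycle. *)
Definition cycle_edges c : {set {set V}} := [set [set x; next c x] | x in c].

Definition is_cycle e (l : nat) (C : {set {set V}}) : Prop :=
  exists c, [/\ size c = l, ucycle e c & C = cycle_edges c].

End Graphs.

(** * The graph [T \cup F], for a graph [T] on ['I_n] and a bipartite graph [F]
      between ['I_n] and a disjoint set ['I_m] *)

Section Union.
Variables n m : nat.

Definition vtx : finType := ('I_n + 'I_m)%type.

Definition unionG (T : rel 'I_n) (F : {set 'I_n * 'I_m}) : rel vtx :=
  fun x y => match x, y with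
  | inl u, inl v => T u v
  | inl u, inr w => (u, w) \in F
  | inr w, inl u => (u, w) \in F
  | inr _, inr _ => false
  end.

Definition edge_of (f : 'I_n * 'I_m) : {set vtx} := [set inl f.1; inr f.2].

(* The vertices are numbered [0, ..., n + m - 1], those of [T] first. *)
Definition code (x : vtx) : nat :=
  match x with inl u => val u | inr w => n + w end.

Definition code_edge (f : 'I_n * 'I_m) : seq nat :=
  [:: code (inl f.1); code (inr f.2)].

(* The input: sizes, root, parent array of the tree, list of the edges of F. *)
Definition encode_input (T : rel 'I_n) (r : 'I_n) (es : seq ('I_n * 'I_m)) :
    seq nat :=
  [:: n; m; size es; val r] ++ [seq val (parent T r v) | v <- enum 'I_n]
    ++ flatten [seq code_edge f | f <- es].

(* [o] lists the elements of [X] without repetition.  A pair (f, C) is written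
   as the two ends of f followed by the [l] vertices of C in cyclic order. *)
Definition encodes_output (e : rel vtx) (l : nat)
    (X : {set ('I_n * 'I_m) * {set {set vtx}}}) (o : seq nat) : Prop :=
  exists xs : seq (('I_n * 'I_m) * seq vtx),
    [/\ forall x, x \in xs -> size x.2 = l /\ ucycle e x.2,
        perm_eq [seq (x.1, cycle_edges x.2) | x <- xs] (enum X) &
        o = flatten [seq code_edge x.1 ++ [seq code v | v <- x.2] | x <- xs]].

End Union.

(** * Algorithms: programs for a deterministic word RAM

    Finitely many registers, a word-addressed random access memory and an
    output tape.  All words are numbers below [2 ^ w]; a computation that
    leaves this range is stuck.  Each node of an evaluated expression and each
    executed command or test takes one unit of time. *)

Inductive binop := Add | Sub | Mul | Div | Mod | Eq | Lt.

Definition apply_binop (b : binop) : nat -> nat -> nat :=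
  match b with
  | Add => addn
  | Sub => subn
  | Mul => muln
  | Div => divn
  | Mod => modn
  | Eq => fun x y => nat_of_bool (x == y)
  | Lt => fun x y => nat_of_bool (x < y)
  end.

Inductive expr :=
  | Const of nat
  | Reg of nat
  | Read of expr
  | Op of binop & expr & expr.

Inductive cmd :=
  | Skip
  | Assign of nat & expr
  | Store of expr & expr
  | Emit of expr
  | Seq of cmd & cmd
  | If of expr & cmd & cmd
  | While of expr & cmd.

Record state := State {
  reg : nat -> nat;
  mem : nat -> nat;
  out : seq nat }.

Definition set_reg (s : state) x v :=
  State [eta reg s with x |-> v] (mem s) (out s).
Definition set_mem (s : state) a v :=
  State (reg s) [eta mem s with a |-> v] (out s).
Definition emit (s : state) v := State (reg s) (mem s) (rcons (out s) v).

Definition word (w v : nat) : option nat := if v < 2 ^ w then Some v else None.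

Fixpoint eval (w : nat) (s : state) (a : expr) : option nat :=
  match a with
  | Const v => word w v
  | Reg x => Some (reg s x)
  | Read a1 => omap (mem s) (eval w s a1)
  | Op b a1 a2 =>
      match eval w s a1, eval w s a2 with
      | Some v1, Some v2 => word w (apply_binop b v1 v2)
      | _, _ => None
      end
  end.

Fixpoint cost (a : expr) : nat :=
  match a with
  | Const _ | Reg _ => 1
  | Read a1 => (cost a1).+1
  | Op _ a1 a2 => (cost a1 + cost a2).+1
  end.

(* [exec w c s t s']: with word length [w], the command [c] started in state
   [s] halts in state [s'] after exactly [t] units of time. *)
Inductive exec (w : nat) : cmd -> state -> nat -> state -> Prop :=
  | ExecSkip s : exec w Skip s 1 s
  | ExecAssign s x a v : eval w s a = Some v ->
      exec w (Assign x a) s (cost a).+1 (set_reg s x v)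
  | ExecStore s a1 a2 v1 v2 : eval w s a1 = Some v1 -> eval w s a2 = Some v2 ->
      exec w (Store a1 a2) s (cost a1 + cost a2).+1 (set_mem s v1 v2)
  | ExecEmit s a v : eval w s a = Some v ->
      exec w (Emit a) s (cost a).+1 (emit s v)
  | ExecSeq s1 s2 s3 c1 c2 t1 t2 : exec w c1 s1 t1 s2 -> exec w c2 s2 t2 s3 ->
      exec w (Seq c1 c2) s1 (t1 + t2) s3
  | ExecIf s s' a c1 c2 v t : eval w s a = Some v ->
      exec w (if v != 0 then c1 else c2) s t s' ->
      exec w (If a c1 c2) s (cost a + t).+1 s'
  | ExecWhileStop s a c : eval w s a = Some 0 ->
      exec w (While a c) s (cost a).+1 s
  | ExecWhileLoop s1 s2 s3 a c v t1 t2 : eval w s1 a = Some v -> v != 0 ->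
      exec w c s1 t1 s2 -> exec w (While a c) s2 t2 s3 ->
      exec w (While a c) s1 (cost a + t1 + t2).+1 s3.

(* The input is in the memory from address 0 on; everything else is 0. *)
Definition initial (inp : seq nat) : state :=
  State (fun=> 0) (fun a => nth 0 inp a) [::].

(* [runs q P inp t o]: on input [inp], the program [P] halts after [t] units
   of time with output [o], on words of [q * log (size inp)] bits. *)
Definition runs (q : nat) (P : cmd) (inp : seq nat) (t : nat) (o : seq nat) :
    Prop :=
  exists s, exec (q * up_log 2 (size inp)) P (initial inp) t s /\ out s = o.

(* Main.v *)
(* Let anc_j u be the ancestor of the leaf u lying j levels above it. If u_0 and
   u_l are leaves with anc_j u_0 = anc_j u_l but anc_(j-1) u_0 <> anc_(j-1) u_l,
   then the tree path between them has length 2j, so that a path of length 2l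
   in F from u_0 to u_l, with l = k - j, closes up to a cycle of length 2k.

   At level j = 1, ..., k-1, the edges (u, w) of F still in play are trimmed in
   2l - 1 rounds. Even rounds group them by the pair (anc_j u, w), odd rounds by
   u, and each round removes the groups of size at most a threshold. An edge
   that survives all the rounds extends greedily to a path u_0 w_1 u_1 ... w_l u_l
   by going through the rounds backwards: the threshold leaves room for avoiding
   the vertices already visited, and that of round 0 also for a last leaf with
   anc_(j-1) u_l <> anc_(j-1) u_0. This works because few edges share both
   anc_(j-1) u and w: the edges removed in even rounds are passed on to level
   j+1, which keeps the number of those with given anc_j u and w in O(k^2 j),
   while those removed in odd rounds, O(k^2) per leaf and level, are discarded.
   For j = k-1 >= h every anc_j u is the root, so in the end all but
   O(k^3 (|L| + |W|)) edges lie on a cycle that has been found, and dividing by k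
   gives the bound.

   Each round is a pass over the list of edges. As the memory is initially zero,
   the groups are stored in sparse tables that need no initialization. *)
Require Import Defs.
From mathcomp Require Import all_boot all_algebra.
From mathcomp Require Import zify.

Set Implicit Arguments.
Unset Strict Implicit.
Unset Printing Implicit Defensive.

(** * Ancestors in a rooted tree *)

Section Distance.
Variables (V : finType) (e : rel V).
Implicit Types (x y v : V).

Lemma walkP x y d :
  reflect (exists p, [/\ size p = d, path e x p & last x p = y]) (walk e x y d).
Proof.
apply: (iffP existsP) => [[p /andP[xp /eqP <-]]|[p [sp xp lp]]].
  by exists p; rewrite size_tuple.
by exists (tcast sp (in_tuple p)); rewrite val_tcast /= xp lp eqxx.
Qed.

Lemma dist_le_walk x y d : walk e x y d -> dist e x y <= d.
Proof.
move=> xyd; rewrite /dist; have [ltd|led] := ltnP d #|V|; last first.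
  by apply: leq_trans led; rewrite -[X in _ <= X](size_iota 0) find_size.
rewrite leqNgt; apply/negP => /(before_find 0); rewrite nth_iota //.
by rewrite add0n xyd.
Qed.

Hypothesis conn : forall x y, connect e x y.

Lemma walk_dist x y : walk e x y (dist e x y).
Proof.
have : has (walk e x y) (iota 0 #|V|).
  have /connectP[p xp ly] := conn x y.
  case/shortenP: xp ly => p' xp' up' _ ly.
  apply/hasP; exists (size p'); last by apply/walkP; exists p'.
  by have := max_card (mem (x :: p')); rewrite (card_uniqP up') mem_iota.
move=> H; have := nth_find 0 H; rewrite nth_iota ?add0n //.
by rewrite -[X in _ < X](size_iota 0) -has_find.
Qed.

Lemma dist_step x y z : e y z -> dist e x z <= (dist e x y).+1.
Proof.
move=> eyz; have /walkP[p [sp xp lp]] := walk_dist x y.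
apply: dist_le_walk; apply/walkP; exists (rcons p z).
by rewrite size_rcons sp rcons_path xp lp eyz last_rcons.
Qed.

Variable r : V.
Local Notation par := (parent e r).

Lemma dist_root : dist e r r = 0.
Proof. by apply/eqP; rewrite -leqn0; apply: dist_le_walk; apply/walkP; exists [::]. Qed.

Lemma dist_eq0 v : dist e r v = 0 -> v = r.
Proof.
by have /walkP[p [sp _ lp]] := walk_dist r v => d0; rewrite d0 in sp; case: p sp lp.
Qed.

Lemma parent_root : par r = r.
Proof.
rewrite /parent; case: pickP => //= u /andP[_].
by rewrite dist_root ltn0.
Qed.

Hypothesis e_sym : symmetric e.

Lemma parentP v : v != r -> e v (par v) /\ (dist e r (par v)).+1 = dist e r v.
Proof.
move=> vr; rewrite /parent; case: pickP => [u /andP[evu lt]|] /=.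
  split=> //; apply/eqP; rewrite eqn_leq lt /=.
  by apply: dist_step; rewrite e_sym.
have /walkP[p [sp rp lp]] := walk_dist r v.
case/lastP: p sp rp lp => [|p z] /=; first by move=> _ _ rv; rewrite rv eqxx in vr.
rewrite size_rcons rcons_path last_rcons => sp /andP[rp ez] zv; subst z.
move/(_ (last r p)); rewrite e_sym ez /= -sp ltnS => /negP[].
by apply: dist_le_walk; apply/walkP; exists p.
Qed.

Definition anc i v := iter i par v.

Lemma anc_add i i' v : anc (i + i') v = anc i (anc i' v).
Proof. exact: iterD. Qed.

Lemma dist_parent v : dist e r (par v) = (dist e r v).-1.
Proof.
have [->|/parentP[_ <-]//] := eqVneq v r.
by rewrite parent_root dist_root.
Qed.

Lemma dist_anc i v : dist e r (anc i v) = dist e r v - i.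
Proof.
elim: i => [|i IH]; first by rewrite subn0.
by rewrite /anc iterS -/(anc i v) dist_parent IH subnS.
Qed.

Lemma anc_edge i v : i < dist e r v -> e (anc i v) (anc i.+1 v).
Proof.
move=> lti; rewrite /anc iterS -/(anc i v).
case: (@parentP (anc i v)) => //; apply/eqP => /(congr1 (dist e r)).
by rewrite dist_anc dist_root => /eqP; rewrite subn_eq0 leqNgt lti.
Qed.

Lemma anc_to_root i v : dist e r v <= i -> anc i v = r.
Proof.
by move=> le; apply: dist_eq0; rewrite dist_anc; apply/eqP; rewrite subn_eq0.
Qed.

Lemma anc_eq_index h j u v a b :
  dist e r u = h -> dist e r v = h -> j < h -> anc j u != anc j v ->
  a <= j.+1 -> b <= j -> anc a u = anc b v -> False.
Proof.
move=> du dv ltj ne aj bj E.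
have ab : a = b by have := congr1 (dist e r) E; rewrite !dist_anc du dv; lia.
by case/eqP: ne; rewrite ab in E; rewrite -(subnK bj) !anc_add E.
Qed.

End Distance.

(** * Trimming the edges level by level *)

Section Trimming.
Variables (n m : nat) (T : rel 'I_n) (r : 'I_n) (k : nat).
Variable es : seq ('I_n * 'I_m).
Local Notation edge := ('I_n * 'I_m)%type.
Local Notation anc := (anc T r).
Implicit Types (st : edge -> nat) (f g : edge) (u y : 'I_n) (w : 'I_m).

(* Levels are numbered from 0 here, so that level [j] is about the ancestors
   [anc j.+1]. An edge in play at level [j] has status [j], and keeps it if it
   survives all the rounds of that level; a discarded edge has status [k.+1]. *)
Definition live st j := [seq f <- es | st f == j].

Definition slack j := 6 * k ^ 2 * j + 1.

Definition thr j i := if i is 0 then slack j + 2 * k else 2 * k.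

Definition key j i f : nat * nat :=
  if odd i then (val f.1, 0) else (val (anc j.+1 f.1), n + f.2).

Definition new_vertex i f : vtx n m := if odd i then inr f.2 else inl f.1.

Definition removed_to j i := if odd i then k.+1 else j.+1.

Definition trim j i st f :=
  if (st f == j) && (count (fun g => key j i g == key j i f) (live st j) <= thr j i)
  then removed_to j i else st f.

Fixpoint trims j i st := if i is i'.+1 then trim j i' (trims j i' st) else st.

Definition rounds j := 2 * (k - j) - 3.

Fixpoint level j := if j is j'.+1 then trims j' (rounds j') (level j') else fun=> 0.

Lemma levelS j : level j.+1 = trims j (rounds j) (level j).
Proof. by []. Qed.

Lemma count_removed st (j i : nat) (q : nat * nat) :
  count (fun f => [&& st f == j, key j i f == q &
    count (fun g => key j i g == key j i f) (live st j) <= thr j i]) es <= thr j i.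
Proof.
set P := (P in count P _).
have [/hasP[f fes /and3P[_ /eqP kf]]|] := boolP (has P es); last first.
  by rewrite has_count -leqNgt leqn0 => /eqP->.
rewrite kf; apply: leq_trans; rewrite /live count_filter.
apply: sub_count => g /and3P[/= -> -> _] //.
Qed.

Section OneLevel.
Variables (j : nat) (st : edge -> nat).
Hypothesis jk : j.+1 < k.
Hypothesis st_range : forall f, st f <= j \/ st f = k.+1.

Lemma trims_range i f : trims j i st f <= j.+1 \/ trims j i st f = k.+1.
Proof.
elim: i f => [|i IH] f /=; first by have [|] := st_range f; lia.
by rewrite /trim /removed_to; case: ifP => // _; case: odd; lia.
Qed.

Lemma trims_dead i u :
  count (fun f => (trims j i st f == k.+1) && (f.1 == u)) es <=
  count (fun f => (st f == k.+1) && (f.1 == u)) es + i * (2 * k).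
Proof.
elim: i => [|i IH] /=; first by rewrite addn0.
rewrite mulSn addnCA.
have [oi|ei] := boolP (odd i); last first.
  apply: leq_trans (leq_trans _ IH) (leq_addl _ _); apply: sub_count => f /=.
  by rewrite /trim /removed_to (negPf ei); case: ifP => // _ /andP[/eqP]; lia.
have <- : thr j i + (count (fun f => (st f == k.+1) && (f.1 == u)) es + i * (2 * k)) =
    2 * k + (count (fun f => (st f == k.+1) && (f.1 == u)) es + i * (2 * k)).
  by case: i oi {IH}.
apply: leq_trans (leq_add (count_removed (trims j i st) j i (val u, 0)) IH).
rewrite -count_predUI.
apply: leq_trans (leq_addr _ _); apply: sub_count => f /=.
rewrite /trim /removed_to; case: ifP => [/andP[-> ->]|_ ->]; last by rewrite orbT.
by move=> /andP[_ /eqP <-]; rewrite /key oi !eqxx.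
Qed.

Lemma trims_promoted i y w :
  count (fun f => [&& trims j i st f == j.+1, anc j.+1 f.1 == y & f.2 == w]) es <=
  (if i == 0 then 0 else slack j) + i * (2 * k).
Proof.
elim: i => [|i IH] /=.
  rewrite leqn0 -[_ == 0]negbK -lt0n -has_count; apply/negP => /hasP[f _ /andP[/eqP]].
  by case: (st_range f); lia.
have [oi|ei] := boolP (odd i).
  apply: leq_trans (leq_trans _ IH) _; last by case: i oi {IH} => //= i _; lia.
  apply: sub_count => f /=; rewrite /trim /removed_to oi.
  by case: ifP => // _ /andP[/eqP]; lia.
apply: (@leq_trans (thr j i + ((if i == 0 then 0 else slack j) + i * (2 * k)))); last first.
  by case: i {IH ei} => [|i] /=; lia.
apply: leq_trans (leq_add (count_removed (trims j i st) j i (val y, n + w)) IH).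
rewrite -count_predUI.
apply: leq_trans (leq_addr _ _); apply: sub_count => f /=.
rewrite /trim /removed_to; case: ifP => [/andP[-> ->]|_ ->]; last by rewrite orbT.
by move=> /and3P[_ /eqP <- /eqP <-]; rewrite /key (negPf ei) !eqxx.
Qed.

Lemma trims_other i f : st f != j -> trims j i st f = st f.
Proof. by move=> sf; elim: i => //= i IH; rewrite /trim IH (negPf sf). Qed.

Lemma mem_live_trims i f :
  f \in live (trims j i.+1 st) j ->
  f \in live (trims j i st) j /\
  thr j i < count (fun g => key j i g == key j i f) (live (trims j i st) j).
Proof.
rewrite !mem_filter /= => /andP[]; rewrite {1}/trim /removed_to.
case: ifP => [_|]; first by case: odd; lia.
by move=> + sf fes; rewrite sf fes /= ltnNge => ->.
Qed.

End OneLevel.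

Lemma trims_ge j i st f : j < k -> st f = j -> j <= trims j i st f.
Proof.
move=> jk sf; elim: i => [|i IH] /=; first by rewrite sf.
by rewrite /trim /removed_to; case: ifP => // _; case: odd; lia.
Qed.

Lemma level_range j f : j < k -> level j f <= j \/ level j f = k.+1.
Proof. by elim: j f => [|j IH] f jk; [left | apply: trims_range => // g; apply: IH; lia]. Qed.

Lemma level_dead j u : j < k ->
  count (fun f => (level j f == k.+1) && (f.1 == u)) es <= j * (4 * k ^ 2).
Proof.
elim: j => [|j IH] jk; first by rewrite leqn0 (@eq_count _ _ pred0) ?count_pred0.
have jr f : level j f <= j \/ level j f = k.+1 by apply: level_range; lia.
apply: leq_trans (trims_dead _ jk _ u) _; rewrite mulSn addnC leq_add ?IH //; last by lia.
by rewrite /rounds; nia.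
Qed.

Hypothesis ues : uniq es.

Lemma level_promoted j y w : j < k ->
  count (fun f => [&& level j f == j, anc j f.1 == y & f.2 == w]) es <= slack j.
Proof.
case: j => [_|j jk].
  rewrite /slack muln0 add0n; apply: (@leq_trans (count_mem (y, w) es)); last first.
    by rewrite (count_uniq_mem _ ues) leq_b1.
  by apply: sub_count => -[u v] /=.
have jr f : level j f <= j \/ level j f = k.+1 by apply: level_range; lia.
apply: leq_trans (trims_promoted jk jr _ y w) _.
have -> : slack j.+1 = slack j + 6 * k ^ 2 by rewrite /slack mulnS; lia.
apply: leq_add; first by case: ifP.
by rewrite /rounds; nia.
Qed.

End Trimming.

(** * From a path in F to a cycle *)

Section Search.
Variables (n m h : nat) (T : rel 'I_n) (r : 'I_n) (k j : nat).
Variables (F : {set 'I_n * 'I_m}) (es : seq ('I_n * 'I_m)).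
Local Notation edge := ('I_n * 'I_m)%type.
Local Notation anc := (anc T r).
Local Notation e := (unionG T F).
Hypothesis symT : symmetric T.
Hypothesis conn : forall x y, connect T x y.
Hypothesis leaf_depth : forall v, v \in leaves T r -> dist T r v = h.
Hypothesis F_leaf : forall u w, (u, w) \in F -> u \in leaves T r.
Hypothesis ues : uniq es.
Hypothesis esF : es =i F.
Hypothesis jk : j.+1 < k.
Variable st : edge -> nat.
Hypothesis st_slack : forall y w,
  count (fun f => [&& st f == j, anc j f.1 == y & f.2 == w]) es <= slack k j.

Local Notation key := (key T r j).
Local Notation trims i := (trims T r k es j i st).
Local Notation live i := (live es (trims i) j).

Lemma unionG_sym : symmetric e.
Proof. by move=> [u|w] [u'|w'] //=; rewrite symT. Qed.

Lemma live_F i f : f \in live i -> f \in F.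
Proof. by rewrite mem_filter => /andP[_]; rewrite esF. Qed.

Definition bad (i : nat) (pv : seq (vtx n m)) (f g : edge) :=
  (new_vertex i g \in pv) || ((i == 0) && (anc j g.1 == anc j f.1)).

Lemma new_vertex_inj i (f g g' : edge) :
  key i g = key i f -> key i g' = key i f -> new_vertex i g = new_vertex i g' -> g = g'.
Proof.
rewrite /key /new_vertex; case: odd; case: g g' f => [u w] [u' w'] [u0 w0] /=.
  by move=> [/val_inj->] [/val_inj->] [->].
by move=> [_ /addnI/val_inj->] [_ /addnI/val_inj->] [->].
Qed.

Lemma count_bad_lt i pv f g :
  size pv <= 2 * k -> g \in live i.+1 ->
  let l := [seq g' <- live i | key i g' == key i g] in
  count (bad i pv f) l < size l /\ count (bad i pv f) l <= thr k j i.
Proof.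
move=> spv /(mem_live_trims jk)[gi]; rewrite -size_filter; set l := filter _ _ => lt l0.
suff le : count (bad i pv f) l <= thr k j i by split=> //; apply: leq_ltn_trans le lt.
rewrite {}/l0.
have c1 : count (fun g' => new_vertex i g' \in pv) l <= 2 * k.
  apply: leq_trans spv; rewrite -size_filter -(size_map (new_vertex i)).
  apply: uniq_leq_size => [|v /mapP[g']]; last by rewrite mem_filter => /andP[? _] ->.
  rewrite map_inj_in_uniq ?filter_uniq // => g1 g2.
  rewrite !mem_filter => /andP[_ /andP[/eqP k1 _]] /andP[_ /andP[/eqP k2 _]].
  exact: new_vertex_inj k1 k2.
case: i gi @l lt c1 => [|i] gi l lt c1; last first.
  by apply: leq_trans c1; apply: sub_count => g' /=; rewrite /bad orbF.
apply: (@leq_trans (count (fun g' => new_vertex 0 g' \in pv) l +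
                     count (fun g' => anc j g'.1 == anc j f.1) l)).
  by rewrite -count_predUI leq_addr.
rewrite [thr _ _ _]addnC leq_add //.
apply: leq_trans (st_slack (anc j f.1) g.2).
rewrite /l !count_filter; apply: sub_count => g'.
move=> /andP[/andP[/= a1 /eqP[_ /addnI/val_inj w1]] a2].
by rewrite a1 w1 eqxx !andbT.
Qed.

(* [pv] is the path found so far, last vertex first; it starts with the edge [f]
   and ends with the edge [g], which has survived all the rounds before round [i]. *)
Definition search_inv i (f : edge) (pv : seq (vtx n m)) (g : edge) :=
  [/\ f \in F, g \in live i, anc j.+1 g.1 = anc j.+1 f.1
    & forall u, inl u \in pv -> u \in leaves T r] /\
  [/\ size pv + i = rounds k j + 2, uniq pv, sorted e pv,
      exists q, pv = rcons (rcons q (inr f.2)) (inl f.1)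
    & exists q, pv = (if odd i then inr g.2 else inl g.1) :: q].

Lemma search_init f : f \in live (rounds k j) ->
  search_inv (rounds k j) f [:: inr f.2; inl f.1] f.
Proof.
move=> fl; have fF := live_F fl; split; split=> //=.
- by move=> u; rewrite in_cons mem_seq1 => /eqP[->]; apply: (@F_leaf _ f.2); case: f fF {fl}.
- by rewrite addnC.
- by case: f fF {fl} => u w /= ->.
- by exists [::].
by exists [:: inl f.1]; rewrite /rounds; case: ifP => //; lia.
Qed.

Lemma search_step i f pv g g' :
  search_inv i.+1 f pv g -> g' \in live i -> key i g' = key i g ->
  new_vertex i g' \notin pv -> search_inv i f (new_vertex i g' :: pv) g'.
Proof.
case=> [[fF gi ag lpv] [spv upv ppv [q qpv] [q' qpv']]] g'i kg nv; split; split=> //=.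
- move: kg; rewrite /key; case: odd => [[/val_inj->]|[/val_inj-> _]]; exact: ag.
- move=> u; rewrite in_cons => /predU1P[|]; last exact: lpv.
  move: (live_F g'i); rewrite /new_vertex; case: g' {g'i kg nv} => u' w' /=.
  by case: odd => // /F_leaf lu' [->].
- by rewrite addSnnS.
- by rewrite nv.
- move: ppv kg (live_F g'i); rewrite qpv' /= /new_vertex /key; case: (odd i) => /= ->.
    by case: g' {nv g'i} => u w /= [/val_inj->] ->.
  by case: g' {nv g'i} => u w /= [_ /addnI/val_inj->] ->.
- by exists (new_vertex i g' :: q); rewrite qpv.
- by exists pv; rewrite /new_vertex.
Qed.

Definition climb a b u := [seq inl (anc i u) : vtx n m | i <- iota a b].

Lemma climb_path b u : b <= dist T r u -> path e (inl u) (climb 1 b u).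
Proof.
have gen a : a + b <= dist T r u -> path e (inl (anc a u)) (climb a.+1 b u).
  elim: b a => // b IH a le.
  rewrite -[path _ _ _]/(T (anc a u) (anc a.+1 u) && path e (inl (anc a.+1 u)) (climb a.+2 b u)).
  rewrite IH ?andbT; last by lia.
  by apply: (anc_edge conn symT); lia.
exact: (gen 0).
Qed.

Lemma climb_rcons b u : climb 1 b.+1 u = rcons (climb 1 b u) (inl (anc b.+1 u)).
Proof.
rewrite -[b.+1](addn1 b) {1}/climb iotaD map_cat cats1.
by congr (rcons _ _); rewrite addnC.
Qed.

Lemma last_climb b u : last (inl u) (climb 1 b u) = inl (anc b u).
Proof.
by case: b => // b; rewrite climb_rcons last_rcons.
Qed.

Definition closing (f g : edge) : seq (vtx n m) := climb 1 j.+1 g.1 ++ rev (climb 1 j f.1).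

Lemma search_cycle f pv g :
  search_inv 0 f pv g -> anc j g.1 != anc j f.1 ->
  let c := rev pv ++ closing f g in
  [/\ size c = 2 * k, ucycle e c & edge_of f \in cycle_edges c].
Proof.
case=> [[fF g0 ag lpv] [spv upv ppv [q qpv] [q' qpv']]] na c.
have gF := live_F g0.
have lf : f.1 \in leaves T r by apply: (@F_leaf _ f.2); case: f fF {na ag qpv c}.
have lg : g.1 \in leaves T r by apply: (@F_leaf _ g.2); case: g gF {na ag qpv' c g0}.
have df := leaf_depth lf; have dg := leaf_depth lg.
have jh : j < h.
  rewrite ltnNge; apply: contra na => hj.
  by rewrite !(anc_to_root conn symT) ?df ?dg.
have sc : size c = 2 * k.
  rewrite /c !size_cat !size_rev !size_map !size_iota; move: spv; rewrite /rounds; clear -jk; lia.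
have cE : c = inl f.1 :: inr f.2 :: rev q ++ closing f g.
  by rewrite /c qpv !rev_rcons.
have depth u i : u \in leaves T r -> dist T r (anc i u) = h - i.
  by move=> /leaf_depth du; rewrite (dist_anc conn r symT) du.
have climb_inj u a b : u \in leaves T r -> a + b <= h.+1 -> uniq (climb a b u).
  move=> lu ab; rewrite map_inj_in_uniq ?iota_uniq // => x y.
  rewrite !mem_iota => xb yb [] /(congr1 (dist T r)); rewrite !depth //; clear -ab xb yb; lia.
have climb_pv u b : u \in leaves T r -> b <= h -> ~~ has (mem pv) (climb 1 b u).
  move=> lu bh; apply/hasPn => _ /mapP[i + ->]; rewrite mem_iota => ib.
  apply/negP => /lpv/leaf_depth; rewrite depth //; clear -ib bh; lia.
have uc : uniq c.
  rewrite /c /closing !cat_uniq !rev_uniq upv !climb_inj ?andbT //; try (clear -jh; lia).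
  rewrite andTb.
  rewrite (eq_has (a2 := mem pv)); last exact: mem_rev.
  rewrite has_cat has_rev negb_or !climb_pv //=; last exact: ltnW.
  apply/hasPn => x; rewrite mem_rev => /mapP[i + ->]; rewrite mem_iota => ij.
  apply/negP => /mapP[i']; rewrite mem_iota => ij' [] E.
  apply: (anc_eq_index conn symT dg df jh na _ _ (esym E)); clear -ij ij'; lia.
have pc : cycle e c.
  have -> : cycle e c = path e (inl f.1) ((inr f.2 :: rev q) ++ climb 1 j.+1 g.1 ++
      rev (inl f.1 :: climb 1 j f.1)).
    by rewrite cE /= rcons_cat -rcons_cat rev_cons !rcons_cat.
  have ls : last (inl f.1) (inr f.2 :: rev q) = inl g.1.
    rewrite -[LHS]/(last (inl f.1) (inl f.1 :: inr f.2 :: rev q)).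
    by rewrite -2!rev_rcons -qpv qpv' rev_cons last_rcons.
  rewrite cat_path ls; apply/andP; split.
    rewrite -[path _ _ _]/(sorted e (inl f.1 :: inr f.2 :: rev q)).
    rewrite -2!rev_rcons -qpv rev_sorted.
    by rewrite (eq_sorted (e' := e)) // => x y; apply: unionG_sym.
  rewrite cat_path climb_path ?dg // last_climb ag -last_climb.
  have <- : belast (inl f.1) (climb 1 j.+1 f.1) = inl f.1 :: climb 1 j f.1.
    by rewrite climb_rcons belast_rcons.
  rewrite rev_path; have := @climb_path j.+1 f.1; rewrite df => /(_ jh).
  by apply: sub_path => x y; rewrite unionG_sym.
split; rewrite /ucycle ?pc //; apply/imsetP; exists (inl f.1); first by rewrite cE mem_head.
by rewrite /edge_of cE /= eqxx.
Qed.

End Search.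

(** * Running time of programs *)

Section Time.
Variables w K : nat.

Fixpoint time_bound c :=
  match c with
  | Skip => 1
  | Assign _ a | Emit a => (cost a).+1
  | Store a1 a2 => (cost a1 + cost a2).+1
  | Seq c1 c2 => time_bound c1 + time_bound c2
  | If a c1 c2 => (cost a + (time_bound c1 + time_bound c2)).+1
  | While a c => K * (cost a + time_bound c).+1 + (cost a).+1
  end.

Definition wp b c (Q : state -> Prop) s :=
  exists t s', [/\ exec w c s t s', t <= b * time_bound c & Q s'].

Variables (b : nat) (Q : state -> Prop) (s : state).

Lemma wp_mono (Q' : state -> Prop) c :
  wp b c Q' s -> (forall s', Q' s' -> Q s') -> wp b c Q s.
Proof. by case=> t [s' [ex le q]] QQ; exists t, s'; split=> //; apply: QQ. Qed.

Lemma wp_seq c1 c2 : wp b c1 (wp b c2 Q) s -> wp b (Seq c1 c2) Q s.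
Proof.
case=> t1 [s1 [ex1 le1 [t2 [s2 [ex2 le2 q]]]]]; exists (t1 + t2), s2; split=> //.
  exact: ExecSeq ex1 ex2.
by rewrite mulnDr leq_add.
Qed.

Hypothesis b_gt0 : 0 < b.

Lemma wp_skip : Q s -> wp b Skip Q s.
Proof. by move=> q; exists 1, s; split=> //; [constructor | rewrite muln1]. Qed.

Lemma wp_assign x a v :
  eval w s a = Some v -> Q (set_reg s x v) -> wp b (Assign x a) Q s.
Proof. by move=> ev q; eexists _, _; split; [exact: ExecAssign ev | exact: leq_pmull |]. Qed.

Lemma wp_store a1 a2 v1 v2 :
  eval w s a1 = Some v1 -> eval w s a2 = Some v2 -> Q (set_mem s v1 v2) ->
  wp b (Store a1 a2) Q s.
Proof. by move=> ev1 ev2 q; eexists _, _; split; [exact: ExecStore ev1 ev2 | exact: leq_pmull |]. Qed.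

Lemma wp_emit a v : eval w s a = Some v -> Q (emit s v) -> wp b (Emit a) Q s.
Proof. by move=> ev q; eexists _, _; split; [exact: ExecEmit ev | exact: leq_pmull |]. Qed.

Lemma wp_if a c1 c2 v :
  eval w s a = Some v -> wp b (if v != 0 then c1 else c2) Q s -> wp b (If a c1 c2) Q s.
Proof.
move=> ev [t [s' [ex le q]]]; exists (cost a + t).+1, s'; split=> //; first exact: ExecIf ev ex.
apply: leq_trans (_ : cost a + b * time_bound (if v != 0 then c1 else c2) < _).
  by rewrite ltnS leq_add2l.
rewrite /= -addSn -[(cost a + (_ + _)).+1]addSn mulnDr leq_add //; first exact: leq_pmull.
by rewrite leq_mul2l; case: ifP; rewrite ?leq_addl ?leq_addr orbT.
Qed.

End Time.

Arguments wp_assign {w K b Q s} b_gt0 {x a} v.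
Arguments wp_store {w K b Q s} b_gt0 {a1 a2} v1 v2.
Arguments wp_emit {w K b Q s} b_gt0 {a} v.
Arguments wp_if {w K b Q s} b_gt0 {a c1 c2} v.

(* The [N] iterations, each within the plain bound of the body, may exceed [K] by the factor [b]. *)
Lemma wp_while w K b N (I : nat -> state -> Prop) a c (Q : state -> Prop) s :
  0 < b -> N <= b * K -> I 0 s ->
  (forall i s, i < N -> I i s ->
     (exists2 v, eval w s a = Some v & v != 0) /\ wp w K 1 c (I i.+1) s) ->
  (forall s, I N s -> eval w s a = Some 0 /\ Q s) ->
  wp w K b (While a c) Q s.
Proof.
move=> b0 NK I0 step stop.
suff loop i s1 : i <= N -> I (N - i) s1 ->
    exists t s', [/\ exec w (While a c) s1 t s',
      t <= i * (cost a + time_bound K c).+1 + (cost a).+1 & Q s'].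
  have [|t [s' [ex le q]]] := loop N s (leqnn _); first by rewrite subnn.
  exists t, s'; split=> //; apply: leq_trans le _.
  rewrite /= mulnDr mulnA leq_add ?leq_pmull // leq_mul2r NK orbT //.
elim: i s1 => [|i IH] s1 iN Ii.
  rewrite subn0 in Ii; have [ev q] := stop s1 Ii.
  by exists (cost a).+1, s1; split=> //; apply: ExecWhileStop.
have lt : N - i.+1 < N by lia.
have [[v ev v0] [t1 [s2 [ex1 le1 I2]]]] := step _ _ lt Ii.
have [||t2 [s3 [ex2 le2 q]]] := IH s2; first by lia.
  by move: I2; rewrite subnSK.
exists (cost a + t1 + t2).+1, s3; split=> //; first exact: ExecWhileLoop ev v0 ex1 ex2.
by move: le1 le2; rewrite mul1n mulSn; lia.
Qed.

Section Eval.
Variables (w : nat) (s : state).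

Lemma eval_const c : c < 2 ^ w -> eval w s (Const c) = Some c.
Proof. by rewrite /= /word => ->. Qed.

Lemma eval_read a v : eval w s a = Some v -> eval w s (Read a) = Some (Defs.mem s v).
Proof. by move=> /= ->. Qed.

Lemma eval_op o a1 a2 v1 v2 v :
  eval w s a1 = Some v1 -> eval w s a2 = Some v2 -> apply_binop o v1 v2 = v -> v < 2 ^ w ->
  eval w s (Op o a1 a2) = Some v.
Proof. by move=> /= -> -> -> lt; rewrite /word lt. Qed.

Lemma eval_emit a v : eval w (emit s v) a = eval w s a.
Proof. by elim: a => //= [a ->|o a1 -> a2 ->]. Qed.

End Eval.

Definition emits := foldr (fun a c => Seq (Emit a) c) Skip.

Lemma wp_emits w K l vs (Q : state -> Prop) s :
  [seq eval w s a | a <- l] = [seq Some v | v <- vs] ->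
  Q (State (reg s) (Defs.mem s) (out s ++ vs)) -> wp w K 1 (emits l) Q s.
Proof.
elim: l vs s => [|a l IH] [|v vs] s //=.
  by move=> _; rewrite cats0; case: s => ? ? ? q; apply: wp_skip.
case=> ev evs q; apply: wp_seq; apply: (wp_emit _ v) => //; apply: (IH vs).
  by rewrite -evs; apply: eq_map => a'; apply: eval_emit.
by rewrite /= cat_rcons.
Qed.

(** * The program *)

Section Program.
Variable k : nat.

Definition rB := 0.
Definition rZ := 1.
Definition rEnd := 2.
Definition rP := 3.
Definition rX := 4.
Definition rA := 5.
Definition rC := 6.
Definition rV i := 10 + i.

Definition anc_expr i a := iter i (fun x => Read (Op Add (Const 4) x)) a.
Definition left_expr x := Read x.
Definition right_expr x := Read (Op Add x (Const 1)).
Definition status_addr := Op Add (Reg rZ) (Reg rP).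
Definition vertex_expr i x := if odd i then right_expr x else left_expr x.

Definition key_expr j i x :=
  if odd i then Op Mul (left_expr x) (Reg rB)
  else Op Add (Op Mul (anc_expr j.+1 (left_expr x)) (Reg rB)) (right_expr x).

(* The groups of round (j, i) are lists stored in the area of Z = B ^ 3 cells
   starting at [tag j i * Z], the one with key q at offset [q * B]: first its
   size, then its edges. An edge is represented by its address p in the input,
   and its status is kept at address [Z + p]. *)
Definition tag j i := 2 + j * (2 * k) + i.

Definition bucket_expr j i x :=
  Op Add (Op Mul (Const (tag j i)) (Reg rZ)) (Op Mul (key_expr j i x) (Reg rB)).

Definition for_edges body :=
  Seq (Assign rP (Op Add (Const 4) (Read (Const 0))))
      (While (Op Lt (Reg rP) (Reg rEnd))
             (Seq body (Assign rP (Op Add (Reg rP) (Const 2))))).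

Definition for_live j body :=
  for_edges (If (Op Eq (Read status_addr) (Const j)) body Skip).

Definition fill j i := for_live j
  (Seq (Assign rA (bucket_expr j i (Reg rP)))
  (Seq (Assign rC (Op Add (Read (Reg rA)) (Const 1)))
  (Seq (Store (Reg rA) (Reg rC))
       (Store (Op Add (Reg rA) (Reg rC)) (Reg rP))))).

Definition purge j i := for_live j
  (If (Op Lt (Const (thr k j i)) (Read (bucket_expr j i (Reg rP)))) Skip
      (Store status_addr (Const (removed_to k j i)))).

Fixpoint trims_cmd j i :=
  if i is i'.+1 then Seq (trims_cmd j i') (Seq (fill j i') (purge j i')) else Skip.

(* [rs] lists the registers holding the path found so far, which starts with the
   left end of the edge at [rP]; [v] evaluates to a candidate for its next vertex. *)
Definition bad_expr j i rs v :=
  foldr (fun x a => Op Add (Op Eq v (Reg x)) a)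
    (if i == 0 then Op Eq (anc_expr j v) (anc_expr j (left_expr (Reg rP))) else Const 0) rs.

Definition step j i rs :=
  Seq (Assign rA (Op Add (bucket_expr j i (Reg rX)) (Const 1)))
  (Seq (While (bad_expr j i rs (vertex_expr i (Read (Reg rA))))
              (Assign rA (Op Add (Reg rA) (Const 1))))
  (Seq (Assign rX (Read (Reg rA)))
  (Seq (Assign (rV i) (vertex_expr i (Reg rX)))
       (Emit (Reg (rV i)))))).

Fixpoint search j i rs :=
  if i is i'.+1 then Seq (step j i' rs) (search j i' (rV i' :: rs)) else Skip.

Definition report_edge j :=
  let R := rounds k j in
  Seq (Assign (rV R.+1) (left_expr (Reg rP)))
  (Seq (Assign (rV R) (right_expr (Reg rP)))
  (Seq (emits [:: Reg (rV R.+1); Reg (rV R); Reg (rV R.+1); Reg (rV R)])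
  (Seq (Assign rX (Reg rP))
  (Seq (search j R [:: rV R; rV R.+1])
       (emits ([seq anc_expr i (left_expr (Reg rX)) | i <- iota 1 j.+1] ++
               rev [seq anc_expr i (left_expr (Reg rP)) | i <- iota 1 j])))))).

Definition report j := for_live j (report_edge j).

Fixpoint levels j :=
  if j is j'.+1 then
    Seq (levels j') (Seq (trims_cmd j' (rounds k j')) (report j'))
  else Skip.

Definition program :=
  Seq (Assign rEnd (Op Add (Op Add (Const 4) (Read (Const 0)))
                           (Op Mul (Const 2) (Read (Const 2)))))
  (Seq (Assign rB (Op Add (Read (Const 0)) (Reg rEnd)))
  (Seq (Assign rZ (Op Mul (Op Mul (Reg rB) (Reg rB)) (Reg rB)))
       (levels k.-1))).

End Program.

Section Correctness.
Variables (n m : nat) (T : rel 'I_n) (r : 'I_n) (k : nat).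
Variable es : seq ('I_n * 'I_m).
Local Notation edge := ('I_n * 'I_m)%type.
Local Notation anc := (anc T r).
Implicit Types (s : state) (st : edge -> nat) (f g : edge) (u : 'I_n).

Let inp := encode_input T r es.
Let N := 4 + n + 2 * size es.
Let B := n + N.
Let Z := B * B * B.

Definition pos f := 4 + n + 2 * index f es.

Lemma size_flatten_edges : size (flatten [seq code_edge f | f <- es]) = 2 * size es.
Proof. by elim: es => //= f l IH; rewrite IH mulnS. Qed.

Lemma size_input : size inp = N.
Proof. by rewrite /inp /encode_input !size_cat size_map size_enum_ord size_flatten_edges addnA. Qed.

Lemma nth_parent u : nth 0 inp (4 + u) = parent T r u.
Proof.
rewrite /inp /encode_input /= nth_cat size_map size_enum_ord ltn_ord.
rewrite (nth_map u) ?size_enum_ord ?ltn_ord //.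
by congr (val (parent T r _)); apply: nth_ord_enum.
Qed.

Lemma nth_edges (l : seq edge) f b : f \in l -> b < 2 ->
  nth 0 (flatten [seq code_edge g | g <- l]) (2 * index f l + b) = nth 0 (code_edge f) b.
Proof.
elim: l => // g l IH; rewrite in_cons [index _ _]/= eq_sym.
rewrite -[flatten _]/(code_edge g ++ flatten [seq code_edge g | g <- l]).
have [<- _|_ fl b2] := eqVneq g f; first by case: b {IH} => [|[|]].
by rewrite mulnS -addnA nth_cat ltnNge leq_addr /= addKn IH.
Qed.

Lemma nth_pos f b : f \in es -> b < 2 -> nth 0 inp (pos f + b) = nth 0 (code_edge f) b.
Proof.
move=> fes b2; rewrite /inp /encode_input.
set hd := [:: _; _; _; _]; set pa := map _ _.
have -> : pos f + b = size hd + (size pa + (2 * index f es + b)).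
  by rewrite /pos size_map size_enum_ord !addnA.
have nth_catr (s1 s2 : seq nat) i : nth 0 (s1 ++ s2) (size s1 + i) = nth 0 s2 i.
  by rewrite nth_cat ltnNge leq_addr addKn.
by rewrite !nth_catr nth_edges.
Qed.

Lemma nth_left f : f \in es -> nth 0 inp (pos f) = f.1.
Proof. by move=> fes; rewrite -[pos f]addn0 nth_pos. Qed.

Lemma nth_right f : f \in es -> nth 0 inp (pos f + 1) = n + f.2.
Proof. by move=> fes; rewrite nth_pos. Qed.

Lemma pos_lt f : f \in es -> pos f + 1 < N.
Proof. by rewrite -index_mem /pos /N; move: (index f es) (size es) => a b; lia. Qed.

Lemma pos_inj : {in es &, injective pos}.
Proof.
move=> f g fes ges E; rewrite -(nth_index f fes) -(nth_index f ges); congr nth.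
by move: E; rewrite /pos; move: (index f es) (index g es); lia.
Qed.

Hypothesis mn : m <= n.

Lemma code_lt (v : vtx n m) : code v < B.
Proof. by rewrite /B /N; case: v => [u|x] /=; [have := ltn_ord u | have := ltn_ord x]; lia. Qed.

Lemma code_inj : injective (@code n m).
Proof.
case=> [u|x] [u'|x'] /= E; first by rewrite (val_inj E).
- by have := ltn_ord u; rewrite E ltnNge leq_addr.
- by have := ltn_ord u'; rewrite -E ltnNge leq_addr.
- by rewrite (val_inj (addnI E)).
Qed.

Definition nkey (q : nat * nat) := q.1 * B + q.2.

Lemma mul_add_inj c a a' d d' : d < c -> d' < c -> a * c + d = a' * c + d' -> a = a' /\ d = d'.
Proof.
move=> dc dc' E; have c0 : 0 < c by lia.
have := congr1 (divn^~ c) E; rewrite /= !divnMDl // !divn_small // !addn0 => aa.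
by split=> //; rewrite aa in E; move/addnI: E.
Qed.

Lemma key_lt j i f : (key T r j i f).1 < n /\ (key T r j i f).2 < B.
Proof.
by rewrite /key; case: odd => /=; split=> //; [rewrite /B /N; lia | apply: (code_lt (inr f.2))].
Qed.

Lemma nkey_inj j i f g : (nkey (key T r j i f) == nkey (key T r j i g)) = (key T r j i f == key T r j i g).
Proof.
apply/eqP/eqP => [|-> //].
have [_ lf] := key_lt j i f; have [_ lg] := key_lt j i g.
by move=> /(mul_add_inj lf lg); case: key => a b; case: key => a' b' /= [-> ->].
Qed.

Lemma nkey_lt j i f : nkey (key T r j i f) < B * B.
Proof.
have [l1 l2] := key_lt j i f; rewrite /nkey.
have : ((key T r j i f).1 + 1) * B <= B * B by rewrite leq_mul2r; apply/orP; right; rewrite /B; lia.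
by rewrite mulnDl mul1n; lia.
Qed.

Variables w K : nat.
Let CB := slack k k + 10 * k ^ 2 + 10.
Hypothesis word_size : CB * Z <= 2 ^ w.
Hypothesis K_gt0 : 0 < K.

Lemma B_ge4 : 4 <= B. Proof. by rewrite /B /N; lia. Qed.

Lemma size_edges_lt : size es < B.
Proof. by rewrite /B /N; move: (size es) => a; lia. Qed.

Lemma B_le_Z : B <= Z.
Proof. by rewrite /Z -mulnA leq_pmulr // muln_gt0; have := B_ge4; case: (B). Qed.

Lemma Z_gt0 : 0 < Z. Proof. by apply: leq_trans B_le_Z; apply: leq_trans B_ge4. Qed.

Lemma small v : v < CB * Z -> v < 2 ^ w.
Proof. by move=> lt; apply: leq_trans lt word_size. Qed.

Lemma smallM c v : c < CB -> v < Z -> c * Z + v < 2 ^ w.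
Proof.
move=> lc lv; apply: small; apply: (@leq_trans (c.+1 * Z)); first by rewrite mulSn; lia.
by rewrite leq_mul2r lc orbT.
Qed.

Lemma small_const c : c < CB -> c < 2 ^ w.
Proof. by move=> lc; apply: small; apply: leq_trans lc _; rewrite leq_pmulr // Z_gt0. Qed.

Lemma eval_const1 s v : v <= 1 -> eval w s (Const v) = Some v.
Proof. by move=> le; apply: eval_const; apply: small_const; apply: (leq_ltn_trans le); rewrite /CB; lia. Qed.

Lemma small_bool (b : bool) : b < 2 ^ w.
Proof. by apply: small_const; apply: (leq_ltn_trans (leq_b1 _)); rewrite /CB; lia. Qed.

Lemma small_Z v : v < Z -> v < 2 ^ w.
Proof. by move=> lv; apply: (@smallM 0) => //; rewrite /CB; lia. Qed.

Lemma small_B v : v <= B -> v < 2 ^ w.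
Proof.
move=> lv; rewrite -[v]add0n; apply: (@leq_ltn_trans (1 * Z + 0)).
  by have := B_le_Z; lia.
by apply: smallM; [rewrite /CB; lia | apply: Z_gt0].
Qed.

Lemma offset_lt q c : q < B * B -> c < B -> q * B + c < Z.
Proof.
move=> lq lc; apply: (@leq_trans (q.+1 * B)); first by rewrite mulSn; lia.
by rewrite /Z leq_mul2r lq orbT.
Qed.

Lemma tag_lt j i : j < k -> i < 2 * k -> tag k j i < CB.
Proof.
move=> jk ik; rewrite /tag /CB; have : j * (2 * k) <= k * (2 * k) by rewrite leq_mul2r ltnW ?orbT.
by rewrite -mulnn; nia.
Qed.

Definition env s :=
  [/\ reg s rB = B, reg s rZ = Z, reg s rEnd = N
    & forall a, a < N -> Defs.mem s a = nth 0 inp a].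

Definition statuses s st := forall f, f \in es -> Defs.mem s (Z + pos f) = st f.

Definition fresh s t := forall a, t * Z <= a -> Defs.mem s a = 0.

Definition bucket j i q (l : seq edge) := [seq f <- l | nkey (key T r j i f) == q].

Definition filled s j i l := forall q, q < B * B ->
  Defs.mem s (tag k j i * Z + q * B) = size (bucket j i q l) /\
  forall c, c < size (bucket j i q l) ->
    Defs.mem s (tag k j i * Z + q * B + c.+1) = nth 0 [seq pos f | f <- bucket j i q l] c.

Section EvalEnv.
Variable s : state.
Hypothesis env_s : env s.

Lemma eval_anc i a u :
  eval w s a = Some (val u) -> eval w s (anc_expr i a) = Some (val (anc i u)).
Proof.
case: env_s => [_ _ _ mi] ea; elim: i => // i IH.
have lt (v : 'I_n) : 4 + v < N by rewrite /N; have := ltn_ord v; lia.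
have -> : val (anc i.+1 u) = Defs.mem s (4 + val (anc i u)).
  by rewrite mi; [rewrite nth_parent | apply: lt].
apply: eval_read.
apply: eval_op IH _ _ => //; first by apply: eval_const; apply: small_B B_ge4.
by apply: small_B; apply: ltnW; apply: leq_trans (lt _) (leq_addl _ _).
Qed.

Variables (x : expr) (f : edge).
Hypotheses (fes : f \in es) (ex : eval w s x = Some (pos f)).

Lemma eval_left : eval w s (left_expr x) = Some (val f.1).
Proof.
case: env_s => [_ _ _ mi]; rewrite (eval_read ex) mi ?nth_left //.
by have := pos_lt fes; lia.
Qed.

Lemma eval_right : eval w s (right_expr x) = Some (n + f.2).
Proof.
case: env_s => [_ _ _ mi]; have lt := pos_lt fes.
have e1 : eval w s (Op Add x (Const 1)) = Some (pos f + 1).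
  apply: eval_op ex _ _ _ => //; first by apply: eval_const; apply: small_B; have := B_ge4; lia.
  by apply: small_B; rewrite /B; lia.
by rewrite (eval_read e1) mi ?nth_right.
Qed.

Lemma eval_vertex i : eval w s (vertex_expr i x) = Some (code (new_vertex i f)).
Proof. by rewrite /vertex_expr /new_vertex; case: odd; [apply: eval_right | apply: eval_left]. Qed.

Lemma eval_key j i : eval w s (key_expr j i x) = Some (nkey (key T r j i f)).
Proof.
case: env_s => [eB _ _ _]; have lt := nkey_lt j i f; have BZ := offset_lt lt.
have lZ : nkey (key T r j i f) < 2 ^ w.
  by apply: small_Z; have := BZ 0; have := B_ge4; nia.
move: lZ; rewrite /key_expr /key /nkey; case: odd => lZ.
  by apply: (eval_op eval_left _ _ lZ) => //=; rewrite ?eB ?addn0 //.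
apply: (eval_op _ eval_right _ lZ) => //.
apply: (@eval_op _ _ Mul _ _ (val (anc j.+1 f.1)) B) => //=.
- by apply: (@eval_anc j.+1); apply: eval_left.
- by rewrite eB.
- by apply: leq_ltn_trans lZ; rewrite leq_addr.
Qed.

Lemma eval_bucket j i : j < k -> i < 2 * k ->
  eval w s (bucket_expr k j i x) = Some (tag k j i * Z + nkey (key T r j i f) * B).
Proof.
move=> jk ik; case: env_s => [eB eZ _ _]; have tl := tag_lt jk ik.
have lt := offset_lt (nkey_lt j i f) (leq_trans (isT : 0 < 4) B_ge4); rewrite addn0 in lt.
have le := smallM tl lt.
apply: (@eval_op _ _ Add _ _ (tag k j i * Z) (nkey (key T r j i f) * B) _ _ _ _ le) => //.
  apply: (@eval_op _ _ Mul _ _ (tag k j i) Z) => //=; last 1 first.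
  - by apply: leq_ltn_trans le; rewrite leq_addr.
  - exact: (eval_const s (small_const tl)).
  - by rewrite eZ.
apply: (@eval_op _ _ Mul _ _ (nkey (key T r j i f)) B) => //=; last 1 first.
- by apply: leq_ltn_trans le; rewrite leq_addl.
- exact: eval_key.
- by rewrite eB.
Qed.

End EvalEnv.

Hypothesis ues : uniq es.

Lemma eval_status s f : env s -> f \in es -> reg s rP = pos f ->
  eval w s status_addr = Some (Z + pos f).
Proof.
case=> [_ eZ _ _] fes ep; apply: (@eval_op _ _ Add _ _ Z (pos f)) => //=; rewrite ?eZ ?ep //.
rewrite -[Z]mul1n; apply: smallM; first by rewrite /CB; lia.
by apply: leq_trans B_le_Z; have := pos_lt fes; rewrite /B; lia.
Qed.

Lemma wp_for_edges (I : seq edge -> state -> Prop) body s (Q : state -> Prop) :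
  env s -> (forall l s, I l s -> env s) ->
  (forall l s v, I l s -> I l (set_reg s rP v)) -> I [::] s ->
  (forall l1 f l2 s, es = l1 ++ f :: l2 -> I l1 s -> reg s rP = pos f ->
     wp w K 1 body (fun s' => I (rcons l1 f) s' /\ reg s' rP = pos f) s) ->
  (forall s, I es s -> Q s) -> wp w K (size es).+1 (for_edges body) Q s.
Proof.
move=> env_s Ienv IP I0 step stop; have NB : N <= B by rewrite leq_addl.
have c4 v : v <= 4 -> v < 2 ^ w by move=> ?; apply: small_B; have := B_ge4; lia.
apply: wp_seq; apply: (wp_assign _ (4 + n)) => //.
  case: env_s => _ _ _ mi; apply: (@eval_op _ _ Add _ _ 4 n) => //.
  - exact: (eval_const s (c4 4 isT)).
  - by rewrite (eval_read (eval_const s (c4 0 isT))) mi.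
  by apply: small_B; apply: leq_trans NB; rewrite /N; lia.
apply: (@wp_while _ _ _ (size es)
  (fun i s => I (take i es) s /\ reg s rP = 4 + n + 2 * i)) => //.
- by apply: (@leq_trans (size es).+1) => //; rewrite leq_pmulr.
- by rewrite take0; split; [apply: IP | rewrite /= muln0 addn0].
- move=> i s1 lt [Ii ep].
  have [f0 _] : exists f0 : edge, true by move: (es) lt => [|f0 ?]; last by exists f0.
  have esE : es = take i es ++ nth f0 es i :: drop i.+1 es by rewrite -drop_nth // cat_take_drop.
  have pf : pos (nth f0 es i) = 4 + n + 2 * i by rewrite /pos index_uniq.
  have [_ _ eE _] := Ienv _ _ Ii.
  have lN : 4 + n + 2 * i < N by rewrite /N; move: (size es) lt => a; lia.
  split.
    by exists 1 => //; apply: (@eval_op _ _ Lt _ _ (4 + n + 2 * i) N); rewrite /= ?ep ?eE ?lN ?c4.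
  apply: wp_seq; apply: wp_mono (step _ _ _ s1 esE Ii _) _; first by rewrite ep pf.
  move=> s2 [I2 ep2]; apply: (wp_assign _ (4 + n + 2 * i.+1)) => //.
    apply: (@eval_op _ _ Add _ _ (4 + n + 2 * i) 2); rewrite /= ?ep2 ?pf //.
    - exact: (eval_const s2 (c4 2 isT)).
    - by rewrite mulnS; lia.
    by apply: small_B; rewrite mulnS; move: lN; rewrite /B; lia.
  by rewrite (take_nth f0) //; split=> //; apply: IP.
move=> s1 [I1 ep]; rewrite take_size in I1; have [_ _ eE _] := Ienv _ _ I1.
split; last exact: stop.
by apply: (@eval_op _ _ Lt _ _ N N); rewrite /= ?ep ?eE ?ltnn ?c4.
Qed.

Lemma wp_for_live st j (I : seq edge -> state -> Prop) body s (Q : state -> Prop) :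
  j < CB -> env s -> (forall l s, I l s -> env s) ->
  (forall l s v, I l s -> I l (set_reg s rP v)) -> I [::] s ->
  (forall l1 f s, f \notin l1 -> f \in es -> I l1 s -> Defs.mem s (Z + pos f) = st f) ->
  (forall l f s, st f != j -> f \in es -> I l s -> I (rcons l f) s) ->
  (forall l1 f l2 s, es = l1 ++ f :: l2 -> f \notin l1 -> f \in es -> st f = j ->
     I l1 s -> reg s rP = pos f ->
     wp w K 1 body (fun s' => I (rcons l1 f) s' /\ reg s' rP = pos f) s) ->
  (forall s, I es s -> Q s) -> wp w K (size es).+1 (for_live j body) Q s.
Proof.
move=> jC env_s Ienv IP I0 Ist Iskip step stop; apply: wp_for_edges stop => // l1 f l2 s1 esE I1 ep.
have c1 v : v <= 1 -> v < 2 ^ w by move=> ?; apply: small_B; have := B_ge4; lia.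
have fes : f \in es by rewrite esE mem_cat mem_head orbT.
have fl1 : f \notin l1 by move: ues; rewrite esE cat_uniq /= negb_or => /and3P[_ /andP[]].
have env1 := Ienv _ _ I1; have ej := eval_read (eval_status env1 fes ep).
rewrite (Ist _ _ _ fl1 fes I1) in ej.
apply: (wp_if _ (st f == j)) => //.
  apply: (@eval_op _ _ Eq _ _ (st f) j) => //; last by apply: c1; case: eqP.
  exact: (eval_const s1 (small_const jC)).
have [sj|sj] := eqVneq (st f) j; first exact: step esE _ _ _ _ _.
by apply: wp_skip => //; split=> //; apply: Iskip.
Qed.

Lemma slack_mono j j' : j <= j' -> slack k j <= slack k j'.
Proof. by move=> le; rewrite /slack leq_add2r leq_mul2l le orbT. Qed.

Lemma thr_lt j i : j < k -> thr k j i < CB.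
Proof.
move=> jk; have : slack k j <= slack k k by apply: slack_mono; apply: ltnW.
by rewrite /thr /CB; case: i => [|i]; nia.
Qed.

Lemma level_lt j : j <= k.+1 -> j < CB.
Proof. by rewrite /CB; nia. Qed.

Lemma tag_ge2 j i : 2 <= tag k j i. Proof. by rewrite /tag -addnA leq_addr. Qed.

Lemma status_area f : f \in es -> Z + pos f < 2 * Z.
Proof. by move=> /pos_lt lt; have := B_le_Z; rewrite /B; lia. Qed.

Lemma set_reg_env s x v : rEnd < x -> env s -> env (set_reg s x v).
Proof. by case: x => [|[|[|x]]] // _ [*]. Qed.

Lemma set_mem_env s a v : N <= a -> env s -> env (set_mem s a v).
Proof.
move=> le [eB eZ eE mi]; split=> // a' lt /=; rewrite ifN ?mi //.
by apply: contraTneq lt => ->; rewrite -leqNgt.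
Qed.

Lemma cell_inj t q q' c c' :
  c < B -> c' < B -> t * Z + q * B + c = t * Z + q' * B + c' -> q = q'.
Proof. by move=> lc lc'; rewrite -!addnA => /addnI E; have [] := mul_add_inj lc lc' E. Qed.

Lemma wp_fill st j i s0 (Q : state -> Prop) : j < k -> i < 2 * k ->
  env s0 -> statuses s0 st -> fresh s0 (tag k j i) ->
  (forall s, env s -> fresh s (tag k j i).+1 ->
     (forall a, a < tag k j i * Z -> Defs.mem s a = Defs.mem s0 a) ->
     filled s j i (live es st j) -> out s = out s0 -> Q s) ->
  wp w K (size es).+1 (fill k j i) Q s0.
Proof.
move=> jk ik env0 st0 fr0 post; set tg := tag k j i in fr0 post *.
have tl := tag_lt jk ik.
pose I (l : seq edge) s := [/\ env s, fresh s tg.+1, (forall a, a < tg * Z -> Defs.mem s a = Defs.mem s0 a),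
  filled s j i (live l st j) & out s = out s0].
apply: (@wp_for_live st j I) => //.
- by apply: level_lt; lia.
- by move=> l s [].
- split=> // [a le|q lq]; first by apply: fr0; apply: leq_trans le; rewrite leq_mul2r leqnSn orbT.
  by split=> //=; rewrite fr0 // leq_addr.
- move=> l f s fl fes [_ _ same _ _]; rewrite same ?st0 //.
  apply: leq_trans (status_area fes) _; by rewrite leq_mul2r tag_ge2 orbT.
- move=> l f s sf fes [*]; split=> //.
  by rewrite /live filter_rcons (negPf sf).
- move=> l1 f l2 s1 esE fl1 fes sf [e1 fr1 same1 fill1 out1] ep.
  set q0 := nkey (key T r j i f); set a0 := tg * Z + q0 * B.
  set L := bucket j i q0 (live l1 st j).
  have lq0 : q0 < B * B by apply: nkey_lt.
  have sl q : (size (bucket j i q (live l1 st j))).+1 < B.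
    have : size (bucket j i q (live l1 st j)) <= size l1.
      by rewrite !size_filter; apply: leq_trans (count_size _ _) _; rewrite size_filter count_size.
    have sl1 : size l1 < size es by rewrite esE size_cat /= addnS ltnS leq_addr.
    by move=> sl; apply: leq_ltn_trans size_edges_lt; apply: leq_ltn_trans sl sl1.
  have sL := sl q0.
  have [mL nthL] := fill1 _ lq0.
  have eA : eval w s1 (bucket_expr k j i (Reg rP)) = Some a0.
    by apply: eval_bucket => //; rewrite /= ep.
  apply: wp_seq; apply: (wp_assign _ a0) => //.
  apply: wp_seq; apply: (wp_assign _ (size L + 1)) => //.
    apply: (@eval_op _ _ Add _ _ (size L) 1) => //; first by rewrite /= mL.
      exact: eval_const1.
    by apply: small_B; rewrite addn1 ltnW.
  apply: wp_seq; apply: (wp_store _ a0 (size L + 1)) => //.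
  apply: (wp_store _ (a0 + (size L + 1)) (pos f)) => //; last 1 first.
  - have a0N : N <= a0.
      apply: leq_trans (leq_addr _ _); apply: leq_trans (leq_addl n _) _.
      by apply: leq_trans B_le_Z _; rewrite leq_pmull // (leq_trans _ (tag_ge2 j i)).
    have a0lt c : c <= (size L).+1 -> a0 + c < tg.+1 * Z.
      by move=> lc; have := offset_lt lq0 (leq_ltn_trans lc sL); rewrite mulSn /a0; lia.
    have a0L c : (a0 == a0 + c.+1) = false.
      by apply/eqP; rewrite -{1}(addn0 a0) => /addnI.
    split=> //; split=> //.
    + apply: set_mem_env; first by rewrite (leq_trans a0N) ?leq_addr.
      by apply: set_mem_env => //; apply: set_reg_env => //; apply: set_reg_env.
    + move=> a le /=; rewrite !ifN ?fr1 //; apply: contraTneq le => ->; rewrite -ltnNge.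
        by rewrite -[a0]addn0 a0lt.
      by rewrite addn1 a0lt.
    + move=> a lt /=; rewrite !ifN ?same1 //; apply: contraTneq lt => ->; rewrite -leqNgt /a0.
        by rewrite leq_addr.
      by rewrite -addnA leq_addr.
    move=> q lq; rewrite /live filter_rcons sf eqxx /bucket filter_rcons -/q0.
    have [mq nthq] := fill1 _ lq; move: mq nthq; rewrite /bucket /live.
    have [<-|qq] := eqVneq q0 q.
      rewrite -/L => mq nthq; rewrite size_rcons; split=> [|c].
        by rewrite /= -/a0 addn1 a0L eqxx.
      rewrite ltnS leq_eqVlt => /predU1P[->|lc] /=.
        by rewrite addn1 eqxx map_rcons nth_rcons size_map ltnn eqxx.
      rewrite -/a0 addn1 eqn_add2l eqSS (ltn_eqF lc) eq_sym a0L nthq //.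
      by rewrite map_rcons nth_rcons size_map lc.
    have neq c c' : c < B -> c' < B -> tg * Z + q * B + c != a0 + c'.
      by move=> lc lc'; apply: contraNneq qq => /(cell_inj lc lc') ->.
    set Lq := [seq _ <- _ | _] => mq nthq.
    have B0 : 0 < B by apply: leq_trans B_ge4.
    have sLq : (size Lq).+1 < B by apply: sl.
    split=> [|c lc] /=.
      rewrite !ifN //; first by have := neq 0 0 B0 B0; rewrite !addn0.
      by have := neq 0 (size L + 1) B0; rewrite !addn0 addn1 => ->.
    have lcB : c.+1 < B by apply: leq_ltn_trans sLq; apply: ltnW.
    rewrite !ifN ?nthq //; first by have := neq _ 0 lcB B0; rewrite addn0.
    by apply: neq => //; rewrite addn1.
  - apply: (@eval_op _ _ Add _ _ a0 (size L + 1)) => //.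
    by rewrite /a0 -addnA; apply: smallM => //; apply: offset_lt => //; rewrite addn1.
  by rewrite /= ep.
by move=> s [*]; apply: post.
Qed.

Lemma wp_purge st j i s0 (Q : state -> Prop) : j < k -> i < 2 * k ->
  env s0 -> statuses s0 st -> filled s0 j i (live es st j) ->
  (forall s, env s -> statuses s (trim T r k es j i st) ->
     (forall a, 2 * Z <= a -> Defs.mem s a = Defs.mem s0 a) ->
     out s = out s0 -> Q s) ->
  wp w K (size es).+1 (purge k j i) Q s0.
Proof.
move=> jk ik env0 st0 fill0 post.
pose I (l : seq edge) s := [/\ env s, statuses s (fun f => if f \in l then trim T r k es j i st f else st f),
  (forall a, 2 * Z <= a -> Defs.mem s a = Defs.mem s0 a) & out s = out s0].
apply: (@wp_for_live st j I) => //.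
- by apply: level_lt; lia.
- by move=> l s [].
- by move=> l f s fl fes [_ sts _ _]; rewrite sts // (negPf fl).
- move=> l f s sf fes [e1 sts *]; split=> // g ges; rewrite sts // mem_rcons inE.
  by case: eqVneq => // ->; rewrite /trim (negPf sf) /=; case: ifP.
- move=> l1 f l2 s1 esE fl1 fes sf [e1 sts same1 out1] ep.
  set c := count (fun g => key T r j i g == key T r j i f) (live es st j).
  have eC : eval w s1 (Read (bucket_expr k j i (Reg rP))) = Some c.
    rewrite (eval_read (eval_bucket e1 fes _ jk ik)) /= ?ep // same1; last first.
      by apply: leq_trans (leq_addr _ _); rewrite leq_mul2r tag_ge2 orbT.
    have [-> _] := fill0 _ (nkey_lt j i f); rewrite /bucket size_filter.
    by congr Some; apply: eq_count => g; apply: nkey_inj.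
  apply: (wp_if _ (thr k j i < c)) => //.
    apply: (@eval_op _ _ Lt _ _ (thr k j i) c) => //.
      by apply: eval_const; apply: small_const; apply: thr_lt.
    exact: small_bool.
  have [lt|le] := ltnP (thr k j i) c.
    apply: wp_skip => //; split=> //; split=> // g ges; rewrite sts // mem_rcons inE.
    by case: eqVneq => // -> ; rewrite (negPf fl1) /trim sf eqxx leqNgt lt.
  apply: (wp_store _ (Z + pos f) (removed_to k j i)) => //.
  - exact: eval_status.
  - by apply: eval_const; apply: small_const; apply: level_lt; rewrite /removed_to; case: odd; lia.
  split=> //; split=> //.
  - by apply: set_mem_env => //; have := B_le_Z; rewrite /B; lia.
  - move=> g ges /=; rewrite mem_rcons inE.
    have [->|gf] := eqVneq g f; first by rewrite eqxx /trim sf eqxx le.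
    rewrite ifN ?sts //; apply: contra gf => /eqP/addnI/pos_inj gf.
    by rewrite gf.
  - move=> a le2 /=; rewrite ifN ?same1 //.
    by apply: contraTneq le2 => ->; rewrite -ltnNge; apply: status_area.
by move=> s [e1 sts same out1]; apply: post => // g ges; rewrite sts // ges.
Qed.

Lemma filled_eq s s' j i st :
  (forall a, tag k j i * Z <= a -> a < (tag k j i).+1 * Z -> Defs.mem s' a = Defs.mem s a) ->
  filled s j i (live es st j) -> filled s' j i (live es st j).
Proof.
move=> same fill q lq; have [m1 m2] := fill q lq.
have sB : size (bucket j i q (live es st j)) < B.
  apply: leq_ltn_trans size_edges_lt; rewrite !size_filter; apply: leq_trans (count_size _ _) _.
  by rewrite size_filter count_size.
have same' c : c < B -> Defs.mem s' (tag k j i * Z + q * B + c) =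
    Defs.mem s (tag k j i * Z + q * B + c).
  move=> lc; have lt := offset_lt lq lc.
  apply: same; first by rewrite -addnA leq_addr.
  by rewrite mulSn -addnA addnC ltn_add2r.
split=> [|c lc]; first by rewrite -[_ + q * B]addn0 same' ?(leq_ltn_trans _ sB) // addn0.
by rewrite same' ?m2 //; apply: leq_ltn_trans sB.
Qed.

Lemma wp_trims j i st s0 (Q : state -> Prop) : j < k -> i <= 2 * k ->
  env s0 -> statuses s0 st -> fresh s0 (tag k j 0) ->
  (forall s, env s -> statuses s (trims T r k es j i st) -> fresh s (tag k j i) ->
     (forall i', i' < i -> filled s j i' (live es (trims T r k es j i' st) j)) ->
     out s = out s0 -> Q s) ->
  wp w K (size es).+1 (trims_cmd k j i) Q s0.
Proof.
move=> jk; elim: i Q => [|i IH] Q ik env0 st0 fr0 post; first by apply: wp_skip => //; apply: post.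
apply: wp_seq; apply: IH => // [|s1 env1 st1 fr1 fill1 out1]; first exact: ltnW.
apply: wp_seq; apply: (wp_fill jk ik env1 st1 fr1) => s2 env2 fr2 same2 fill2 out2.
have st2 : statuses s2 (trims T r k es j i st).
  move=> f fes; rewrite same2 ?st1 //; apply: leq_trans (status_area fes) _.
  by rewrite leq_mul2r tag_ge2 orbT.
apply: (wp_purge jk ik env2 st2 fill2) => s3 env3 st3 same3 out3.
have same3' i' a : tag k j i' * Z <= a -> Defs.mem s3 a = Defs.mem s2 a.
  by move=> le; apply: same3; apply: leq_trans le; rewrite leq_mul2r tag_ge2 orbT.
apply: post => //; last by rewrite out3 out2.
  move=> a; rewrite /tag addnS => le; rewrite (same3' i) ?fr2 //.
  by apply: leq_trans le; rewrite leq_mul2r leqnSn orbT.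
move=> i'; rewrite ltnS leq_eqVlt => /predU1P[->|lt].
  by apply: filled_eq fill2 => a le _; apply: same3' le.
apply: filled_eq (fill1 i' lt) => a le1 le2; rewrite (same3' i') // same2 //.
by apply: leq_trans le2 _; rewrite leq_mul2r -addnS leq_add2l lt orbT.
Qed.

Lemma map_set_reg s x v rs : x \notin rs -> map (reg (set_reg s x v)) rs = map (reg s) rs.
Proof.
by move=> xrs; apply/eq_in_map => y yrs /=; rewrite ifN //; apply: contraNneq xrs => <-.
Qed.

Lemma find_predC_le_count (A : Type) (a : pred A) l : find (predC a) l <= count a l.
Proof. by elim: l => //= x l IH; case: (a x). Qed.

Lemma eval_memb s rs v a x b : size rs <= 2 * k ->
  eval w s v = Some x -> eval w s a = Some b -> b <= 1 ->
  exists2 c, eval w s (foldr (fun y a => Op Add (Op Eq v (Reg y)) a) a rs) = Some c &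
    (c != 0) = (x \in map (reg s) rs) || (b != 0).
Proof.
move=> srs ev ea b1.
suff: exists c, [/\ eval w s (foldr (fun y a => Op Add (Op Eq v (Reg y)) a) a rs) = Some c,
    c <= size rs + 1 & (c != 0) = (x \in map (reg s) rs) || (b != 0)].
  by case=> c [e1 _ e2]; exists c.
elim: rs srs => [|y rs IH] srs; first by exists b.
have [|c [ec cs cE]] := IH; first exact: ltnW.
exists ((x == reg s y) + c); split.
- apply: (@eval_op _ _ Add _ _ (x == reg s y) c) => //.
    apply: (@eval_op _ _ Eq _ _ x (reg s y)) => //.
    exact: small_bool.
  apply: small_const; move: srs => /= srs; case: (x == _); rewrite /CB; nia.
- by rewrite /= addSn -add1n leq_add // leq_b1.
by rewrite /= in_cons -orbA -cE; case: (x == _).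
Qed.

Lemma eval_bad s j i rs pv v f g : env s -> f \in es -> reg s rP = pos f -> size rs <= 2 * k ->
  map (reg s) rs = map (@code n m) pv -> eval w s v = Some (code (new_vertex i g)) ->
  exists2 c, eval w s (bad_expr j i rs v) = Some c & (c != 0) = bad T r j i pv f g.
Proof.
move=> env_s fes ep srs rpv ev; rewrite /bad -(mem_map code_inj) -rpv.
case: i ev => [|i] ev; last first.
  have c0 := @eval_const1 s 0 isT.
  by have [c ec cE] := eval_memb srs ev c0 (leqnSn 0); exists c.
have e1 := eval_left env_s fes (x := Reg rP) (congr1 Some ep).
have [] := @eval_memb s rs v (Op Eq (anc_expr j v) (anc_expr j (left_expr (Reg rP))))
  _ (val (anc j g.1) == val (anc j f.1)) srs ev.
- apply: (@eval_op _ _ Eq _ _ (val (anc j g.1)) (val (anc j f.1))) => //.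
  + exact: eval_anc.
  + exact: eval_anc.
  exact: small_bool.
- exact: leq_b1.
by move=> c ec cE; exists c => //; rewrite cE eqb0 negbK eqxx.
Qed.

Variables (h : nat) (F : {set edge}).
Hypothesis symT : symmetric T.
Hypothesis conn : forall x y, connect T x y.
Hypothesis leaf_depth : forall v, v \in leaves T r -> dist T r v = h.
Hypothesis F_leaf : forall u x, (u, x) \in F -> u \in leaves T r.
Hypothesis esF : es =i F.
Hypothesis K_large : forall j i, j < k -> thr k j i <= K.

Section Report.
Variables (j : nat) (st : edge -> nat).
Hypothesis jk : j.+1 < k.
Hypothesis st_slack : forall y x,
  count (fun f => [&& st f == j, anc j f.1 == y & f.2 == x]) es <= slack k j.
Local Notation live i := (live es (trims T r k es j i st) j).
Local Notation search_inv := (search_inv T r k j F es st).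

Variable s0 : state.
Hypothesis fill0 : forall i, i < rounds k j -> filled s0 j i (live i).
Variable f : edge.
Hypothesis fes : f \in es.
Variable o : seq nat.

Definition searching rs pv g s :=
  [/\ env s, Defs.mem s =1 Defs.mem s0 & reg s rP = pos f] /\
  [/\ reg s rX = pos g, map (reg s) rs = map (@code n m) pv
    & out s = o ++ code_edge f ++ map (@code n m) (rev pv)].

Lemma searching_set_reg x v rs pv g s : rX < x -> x \notin rs ->
  searching rs pv g s -> searching rs pv g (set_reg s x v).
Proof.
move=> lx xrs [[e1 m1 p1] [x1 r1 o1]]; split; split=> //.
- by apply: set_reg_env => //; apply: ltn_trans lx.
- by rewrite /= ifN // neq_ltn (ltn_trans _ lx).
- by rewrite /= ifN // neq_ltn lx.
by rewrite map_set_reg.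
Qed.

Lemma search_key g i : bucket j i (nkey (key T r j i g)) (live i) =
  [seq g' <- live i | key T r j i g' == key T r j i g].
Proof. by apply: eq_filter => g'; apply: nkey_inj. Qed.

Lemma wp_step i rs pv g s :
  i < rounds k j -> all (leq (rV i.+1)) rs -> search_inv i.+1 f pv g -> searching rs pv g s ->
  wp w K 1 (step k j i rs) (fun s' => exists g',
    [/\ search_inv i f (new_vertex i g' :: pv) g',
        searching (rV i :: rs) (new_vertex i g' :: pv) g' s'
      & i = 0 -> anc j g'.1 != anc j f.1]) s.
Proof.
move=> iR ars inv srch; have [[fF gl ag _] [spv _ _ _ _]] := inv.
have jk' : j < k by lia.
have ik : i < 2 * k by move: iR; rewrite /rounds; lia.
have spv2 : size pv <= 2 * k by move: spv; rewrite /rounds; lia.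
have ges : g \in es by move: gl; rewrite mem_filter => /andP[].
have [[e1 m1 p1] [x1 r1 o1]] := srch.
have rAn : rA \notin rs by apply/negP => /(allP ars).
have rXn : rX \notin rs by apply/negP => /(allP ars).
have rVn : rV i \notin rs by apply/negP => /(allP ars); rewrite /= /rV addnS ltnn.
have srs : size rs = size pv by rewrite -(size_map (reg s)) r1 size_map.
have [] := count_bad_lt ues jk st_slack f spv2 gl.
set l := [seq g' <- _ | _] => lt_bad bad_thr.
set a0 := tag k j i * Z + nkey (key T r j i g) * B.
have lE : bucket j i (nkey (key T r j i g)) (live i) = l by apply: search_key.
have [_ nthl] := fill0 iR (nkey_lt j i g); rewrite lE -/a0 in nthl.
have les g' : g' \in l -> g' \in es by rewrite !mem_filter => /and3P[].
have sl : size l < B.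
  by apply: leq_ltn_trans size_edges_lt; rewrite !size_filter; apply: leq_trans (count_size _ _) _;
     rewrite size_filter count_size.
have a0lt c : c < B -> a0 + c < 2 ^ w.
  move=> lc; rewrite /a0 -addnA; apply: smallM; first exact: tag_lt.
  by apply: offset_lt => //; apply: nkey_lt.
pose N0 := find (predC (bad T r j i pv f)) l.
have N0l : N0 < size l.
  rewrite -has_find has_count; move: lt_bad; rewrite -(count_predC (bad T r j i pv f) l).
  by rewrite -{1}[count _ _]addn0 ltn_add2l.
have eX : eval w s (bucket_expr k j i (Reg rX)) = Some a0.
  by apply: eval_bucket => //; rewrite /= x1.
have e_1 s' := @eval_const1 s' 1 isT.
have evalA c s' : c < size l -> searching rs pv g s' -> reg s' rA = a0 + c.+1 ->
    eval w s' (Read (Reg rA)) = Some (pos (nth g l c)).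
  move=> lc [[_ m2 _] _] ea; rewrite (eval_read (v := a0 + c.+1)) /= ?ea //.
  by rewrite m2 nthl // (nth_map g).
have evalV c s' : c < size l -> searching rs pv g s' -> reg s' rA = a0 + c.+1 ->
    exists2 b, eval w s' (bad_expr j i rs (vertex_expr i (Read (Reg rA)))) = Some b &
      (b != 0) = bad T r j i pv f (nth g l c).
  move=> lc sr ea; have [[e2 m2 p2] [x2 r2 _]] := sr.
  apply: eval_bad => //; first by rewrite srs.
  by apply: eval_vertex => //; [apply: les; apply: mem_nth | apply: evalA].
apply: wp_seq; apply: (wp_assign _ (a0 + 1)) => //.
  by apply: (@eval_op _ _ Add _ _ a0 1) => //; apply: a0lt; apply: leq_trans B_ge4.
apply: wp_seq; apply: (@wp_while _ _ _ N0
  (fun c s' => searching rs pv g s' /\ reg s' rA = a0 + c.+1)) => //.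
- rewrite mul1n; apply: leq_trans (find_predC_le_count _ _) _.
  by apply: leq_trans bad_thr _; apply: K_large.
- by split; [apply: searching_set_reg | rewrite /= addn1].
- move=> c s1 lc [sr ea]; have lc' := ltn_trans lc N0l.
  have [b eb bE] := evalV c s1 lc' sr ea.
  split; first by exists b => //; rewrite bE; have /negbFE := before_find g lc.
  apply: (wp_assign _ (a0 + c.+2)) => //.
    apply: (@eval_op _ _ Add _ _ (a0 + c.+1) 1) => //; first by rewrite /= ea.
      by rewrite /= -addnA addn1.
    by apply: a0lt; apply: leq_ltn_trans sl; apply: leq_ltn_trans N0l.
  by split; [apply: searching_set_reg | rewrite /=].
move=> s1 [sr ea]; have [b eb bE] := evalV N0 s1 N0l sr ea.
have ngood : ~~ bad T r j i pv f (nth g l N0).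
  by apply: (@nth_find _ g (predC (bad T r j i pv f))); rewrite has_find.
have b0 : b = 0 by apply/eqP; rewrite -[_ == 0]negbK bE.
rewrite b0 in eb; split=> //.
set g' := nth g l N0 in ngood.
have g'l : g' \in l by apply: mem_nth.
have [kg' g'live] : key T r j i g' = key T r j i g /\ g' \in live i.
  by move: g'l; rewrite mem_filter => /andP[/eqP].
have [[e2 m2 p2] [x2 r2 o2]] := sr.
apply: wp_seq; apply: (wp_assign _ (pos g')) => //; first exact: evalA.
apply: wp_seq; apply: (wp_assign _ (code (new_vertex i g'))) => //.
  by apply: eval_vertex => //; apply: les.
have evR : eval w (set_reg (set_reg s1 rX (pos g')) (rV i) (code (new_vertex i g')))
  (Reg (rV i)) = Some (code (new_vertex i g')) by rewrite /= eqxx.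
apply: (wp_emit _ _ evR) => //; exists g'; split.
- by apply: search_step inv g'live kg' _ => //; apply: contra ngood; rewrite /bad => ->.
- split; split=> //=.
    rewrite eqxx -r2; congr cons.
    by rewrite -[LHS]/(map (reg (set_reg (set_reg s1 rX _) (rV i) _)) rs) !map_set_reg.
  by rewrite o2 rev_cons map_rcons rcons_cat.
by move=> i0; move: ngood; rewrite /bad i0 negb_or => /andP[].
Qed.

Lemma wp_search i rs pv g s :
  i <= rounds k j -> all (leq (rV i)) rs -> search_inv i f pv g -> searching rs pv g s ->
  (i = 0 -> anc j g.1 != anc j f.1) ->
  wp w K 1 (search k j i rs) (fun s' => exists rs' pv' g',
    [/\ search_inv 0 f pv' g', searching rs' pv' g' s' & anc j g'.1 != anc j f.1]) s.
Proof.
elim: i rs pv g s => [|i IH] rs pv g s iR ars inv srch na.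
  by apply: wp_skip => //; exists rs, pv, g; split=> //; apply: na.
apply: wp_seq; apply: wp_mono (wp_step iR ars inv srch) _ => s' [g' [inv' srch' na']].
apply: IH inv' srch' na'; first exact: ltnW.
rewrite /= leqnn; apply: sub_all ars => x; apply: leq_trans.
by rewrite leq_add2l.
Qed.

Definition good_cycle (x : edge * seq (vtx n m)) :=
  [/\ size x.2 = 2 * k, ucycle (unionG T F) x.2 & edge_of x.1 \in cycle_edges x.2].

Definition code_pair (x : edge * seq (vtx n m)) := code_edge x.1 ++ [seq code v | v <- x.2].

End Report.

Lemma rounds_gt0 j : j.+1 < k -> 0 < rounds k j.
Proof. by rewrite /rounds; lia. Qed.

Lemma wp_report_edge j st f s0 :
  j.+1 < k ->
  (forall y x, count (fun f => [&& st f == j, anc j f.1 == y & f.2 == x]) es <= slack k j) ->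
  (forall i, i < rounds k j -> filled s0 j i (live es (trims T r k es j i st) j)) ->
  env s0 -> f \in es -> f \in live es (trims T r k es j (rounds k j) st) j -> reg s0 rP = pos f ->
  wp w K 1 (report_edge k j)
  (fun s => exists c, [/\ good_cycle (f, c), env s, Defs.mem s =1 Defs.mem s0,
     reg s rP = pos f & out s = out s0 ++ code_pair (f, c)]) s0.
Proof.
move=> jk st_slack fill0 env0 fes fl ep; pose R := rounds k j.
have e1 := eval_left env0 fes (x := Reg rP) (congr1 Some ep).
apply: wp_seq; apply: (wp_assign _ (val f.1)) => //.
set s1 := set_reg _ _ _.
have env1 : env s1 by apply: set_reg_env.
apply: wp_seq; apply: (wp_assign _ (n + f.2)) => //.
  by apply: eval_right => //; rewrite /= ep.
set s2 := set_reg _ _ _.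
have r1 : reg s2 (rV R.+1) = f.1.
  by rewrite /s2 /= ifN ?eqxx // /rV addnS neq_ltn ltnSn orbT.
have r2 : reg s2 (rV R) = n + f.2 by rewrite /s2 /= eqxx.
apply: wp_seq; apply: (@wp_emits _ _ _ (code_edge f ++ code_edge f)).
  rewrite -[LHS]/[:: Some (reg s2 (rV R.+1)); Some (reg s2 (rV R));
                    Some (reg s2 (rV R.+1)); Some (reg s2 (rV R))].
  by rewrite r1 r2.
apply: wp_seq; apply: (wp_assign _ (pos f)) => //; first by rewrite /= ep.
have inv := search_init F_leaf ues esF jk fl.
have R0 := rounds_gt0 jk.
apply: wp_seq; apply: wp_mono.
  apply: (wp_search (s0 := s0) (o := out s0) jk st_slack fill0 fes (leqnn _) _ inv).
  - by rewrite /= /rV addnS leqnn leqnSn.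
  - split; split=> //.
    by rewrite -[LHS]/[:: reg s2 (rV R); reg s2 (rV R.+1)] r1 r2.
  by move=> R00; rewrite R00 in R0.
move=> s3 [rs [pv [g [inv3 [[e3 m3 p3] [x3 _ o3]] na]]]].
have [[_ gl _ _] _] := inv3.
have ges : g \in es by move: gl; rewrite mem_filter => /andP[].
apply: (@wp_emits _ _ _ [seq code v | v <- closing T r j f g]).
  have el := eval_left e3 ges (x := Reg rX) (congr1 Some x3).
  have er := eval_left e3 fes (x := Reg rP) (congr1 Some p3).
  rewrite /closing !map_cat !map_rev /climb -!map_comp; congr (_ ++ rev _).
    by apply: eq_map => i; apply: eval_anc.
  by apply: eq_map => i; apply: eval_anc.
exists (rev pv ++ closing T r j f g); split=> //.
- exact: (search_cycle symT conn leaf_depth F_leaf ues esF jk inv3 na).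
rewrite -[LHS]/(out s3 ++ [seq code v | v <- closing T r j f g]) o3.
have -> (c : seq (vtx n m)) : code_pair (f, c) = code_edge f ++ map (@code n m) c by [].
by rewrite map_cat -!catA.
Qed.

Lemma wp_report j st s0 (Q : state -> Prop) :
  let st' := trims T r k es j (rounds k j) st in
  j.+1 < k ->
  (forall y x, count (fun f => [&& st f == j, anc j f.1 == y & f.2 == x]) es <= slack k j) ->
  (forall i, i < rounds k j -> filled s0 j i (live es (trims T r k es j i st) j)) ->
  env s0 -> statuses s0 st' ->
  (forall s xs, env s -> Defs.mem s =1 Defs.mem s0 ->
     (forall x, x \in xs -> good_cycle x) -> [seq x.1 | x <- xs] = live es st' j ->
     out s = out s0 ++ flatten [seq code_pair x | x <- xs] -> Q s) ->
  wp w K (size es).+1 (report k j) Q s0.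
Proof.
move=> st' jk st_slack fill0 env0 st0 post.
pose I (l : seq edge) s := [/\ env s, Defs.mem s =1 Defs.mem s0
  & exists xs, [/\ forall x, x \in xs -> good_cycle x, [seq x.1 | x <- xs] = live l st' j
      & out s = out s0 ++ flatten [seq code_pair x | x <- xs]]].
apply: (@wp_for_live st' j I) => //.
- by apply: level_lt; lia.
- by move=> l s [].
- by split=> //; exists [::]; split=> //=; rewrite cats0.
- by move=> l1 f s _ fes [_ m1 _]; rewrite m1; apply: st0.
- move=> l f s sf _ [e1 m1 [xs [gxs x1 o1]]]; split=> //; exists xs; split=> //.
  by rewrite /live filter_rcons (negPf sf).
- move=> l1 f l2 s1 esE fl1 fes sf [e1 m1 [xs [gxs x1 o1]]] ep.
  have fl : f \in live es st' j by rewrite mem_filter sf eqxx.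
  have fill1 i : i < rounds k j -> filled s1 j i (live es (trims T r k es j i st) j).
    by move=> iR; apply: filled_eq (fill0 i iR) => a _ _; apply: m1.
  apply: wp_mono (wp_report_edge jk st_slack fill1 e1 fes fl ep) _.
  move=> s2 [c [gc e2 m2 p2 o2]]; split=> //; split=> //; first by move=> a; rewrite m2 m1.
  exists (rcons xs (f, c)); split.
  + by move=> x; rewrite mem_rcons inE => /predU1P[->//|]; apply: gxs.
  + by rewrite map_rcons x1 /live filter_rcons sf eqxx.
  by rewrite o2 o1 map_rcons flatten_rcons catA.
by move=> s [e1 m1 [xs [gxs x1 o1]]]; apply: post o1.
Qed.

Lemma tagS j i : i <= 2 * k -> tag k j i <= tag k j.+1 0.
Proof. by rewrite /tag mulSn; lia. Qed.

Lemma fresh_le s t t' : t <= t' -> fresh s t -> fresh s t'.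
Proof. by move=> le fr a ta; apply: fr; apply: leq_trans ta; rewrite leq_mul2r le orbT. Qed.

Lemma rounds_le j : rounds k j <= 2 * k. Proof. by rewrite /rounds; lia. Qed.

Hypothesis k1 : 1 < k.
Local Notation level := (level T r k es).

Lemma level_lt_succ j f : j < k -> (level j.+1 f < j.+1) = (level j f < j) || (level j.+1 f == j).
Proof.
move=> jk; rewrite levelS; have [sf|sf] := eqVneq (level j f) j; last first.
  rewrite trims_other // (negPf sf) orbF.
  by have [le|E] := level_range T r es f jk; rewrite ?E; lia.
by rewrite sf ltnn ltnS eqn_leq (trims_ge _ _ _ _ jk sf) andbT.
Qed.

Lemma wp_levels j s0 (Q : state -> Prop) :
  j < k -> env s0 -> statuses s0 (fun=> 0) -> fresh s0 2 -> out s0 = [::] ->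
  (forall s xs, env s -> statuses s (level j) -> fresh s (tag k j 0) ->
     (forall x, x \in xs -> good_cycle x) -> uniq [seq x.1 | x <- xs] ->
     [seq x.1 | x <- xs] =i [seq f <- es | level j f < j] ->
     out s = flatten [seq code_pair x | x <- xs] -> Q s) ->
  wp w K (size es).+1 (levels k j) Q s0.
Proof.
move=> + env0 st0 fr0 o0; elim: j Q => [|j IH] Q jk post.
  apply: wp_skip => //; apply: (post s0 [::]) => //.
  by move=> f; rewrite (eq_filter (a2 := pred0)) ?filter_pred0.
have jk' : j < k by apply: ltnW.
apply: wp_seq; apply: IH => // s1 xs1 env1 st1 fr1 g1 u1 m1 o1.
apply: wp_seq; apply: (wp_trims jk' (rounds_le j) env1 st1 fr1) => s2 env2 st2 fr2 fill2 o2.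
have slk y x := level_promoted T r ues y x jk'.
apply: (wp_report jk slk fill2 env2 st2) => s3 xs env3 m3 g3 x3 o3.
have E : [seq x.1 | x <- xs1 ++ xs] = [seq x.1 | x <- xs1] ++ live es (level j.+1) j.
  by rewrite map_cat x3.
apply: (post s3 (xs1 ++ xs)) => //.
- by move=> f fes; rewrite m3 st2.
- by move=> a ta; rewrite m3; apply: fresh_le fr2 _ ta; apply: tagS; apply: rounds_le.
- by move=> x; rewrite mem_cat => /orP[/g1|/g3].
- rewrite E cat_uniq u1 filter_uniq // andbT; apply/hasPn => f /=.
  rewrite m1 !mem_filter => /andP[sf _]; apply/negP => /andP[lt _].
  have ne : level j f != j by rewrite neq_ltn lt.
  by move: sf; rewrite /= trims_other // (negPf ne).
- move=> f; rewrite E mem_cat m1 !mem_filter -andb_orl.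
  by rewrite -level_lt_succ.
by rewrite map_cat flatten_cat o3 o2 o1.
Qed.

Lemma wp_program (Q : state -> Prop) :
  (forall s xs, (forall x, x \in xs -> good_cycle x) -> uniq [seq x.1 | x <- xs] ->
     [seq x.1 | x <- xs] =i [seq f <- es | level k.-1 f < k.-1] ->
     out s = flatten [seq code_pair x | x <- xs] -> Q s) ->
  wp w K (size es).+1 (program k) Q (initial inp).
Proof.
move=> post; set s0 := initial inp.
have c4 v : v <= 4 -> v < 2 ^ w by move=> ?; apply: small_B; have := B_ge4; lia.
have ec v s : v <= 4 -> eval w s (Const v) = Some v by move=> le; apply: eval_const; apply: c4.
have NB : N <= B by rewrite leq_addl.
have BBZ : B * B < 2 ^ w.
  by apply: small_Z; rewrite /Z ltn_Pmulr ?muln_gt0; have := B_ge4; case: (B) => [|[]].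
apply: wp_seq; apply: (wp_assign _ N) => //.
  apply: (@eval_op _ _ Add _ _ (4 + n) (2 * size es)) => //; last exact: small_B.
  - apply: (@eval_op _ _ Add _ _ 4 n) => //; first exact: ec.
    + exact: (eval_read (ec 0 s0 isT)).
    by apply: small_B; apply: leq_trans NB; rewrite /N leq_addr.
  apply: (@eval_op _ _ Mul _ _ 2 (size es)) => //; first exact: ec.
  + exact: (eval_read (ec 2 s0 isT)).
  by apply: small_B; apply: leq_trans NB; rewrite /N leq_addl.
apply: wp_seq; apply: (wp_assign _ B) => //.
  apply: (@eval_op _ _ Add _ _ n N) => //; last exact: small_B.
  exact: (eval_read (ec 0 _ isT)).
apply: wp_seq; apply: (wp_assign _ Z) => //.
  apply: (@eval_op _ _ Mul _ _ (B * B) B) => //; first exact: (@eval_op _ _ Mul _ _ B B).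
  rewrite -[Z]addn0 -[Z]mul1n; apply: smallM; last exact: Z_gt0.
  by rewrite /CB; lia.
have fr a : N <= a -> nth 0 inp a = 0 by move=> le; rewrite nth_default ?size_input.
apply: wp_levels => //.
- by rewrite ltn_predL; apply: ltnW.
- by move=> f fes; apply: fr; apply: leq_trans NB (leq_trans B_le_Z (leq_addr _ _)).
- by move=> a le; apply: fr; apply: leq_trans NB (leq_trans B_le_Z (leq_trans _ le)); rewrite leq_pmull.
by move=> s xs _ _ _; apply: post.
Qed.

End Correctness.

(** * The number of edges lost *)


Lemma count_le_sum (S : Type) (I : finType) (a : S -> I) (P : pred S) (A : pred I) l :
  all (fun x => P x ==> A (a x)) l ->
  count P l <= \sum_(i | A i) count (fun x => P x && (a x == i)) l.
Proof.
elim: l => //= x l IH /andP[Ax Al]; rewrite big_split /= leq_add ?IH //.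
case: (P x) Ax => //= Aax; rewrite (bigD1 (a x)) //= eqxx.
exact: leq_addr.
Qed.

Lemma loss_bound n m h (T : rel 'I_n) r k (es : seq ('I_n * 'I_m)) :
  symmetric T -> (forall x y, connect T x y) ->
  (forall v, v \in leaves T r -> dist T r v = h) ->
  (forall f, f \in es -> f.1 \in leaves T r) ->
  uniq es -> 1 < k -> h < k ->
  size es <= count (fun f => level T r k es k.-1 f < k.-1) es +
    7 * k ^ 3 * (#|leaves T r| + m).
Proof.
move=> symT conn leaf_depth es_leaf ues k1 hk.
set lv := level T r k es k.-1; have k'k : k.-1 < k by lia.
have range f : lv f <= k.-1 \/ lv f = k.+1 by apply: level_range.
have split3 : size es <= count (fun f => lv f < k.-1) es +
    (count (fun f => lv f == k.+1) es + count (fun f => lv f == k.-1) es).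
  elim: (es) => //= f l IH; have := range f.
  by case: (ltngtP (lv f) k.-1); case: eqP => /=; lia.
apply: leq_trans split3 _; rewrite leq_add2l mulnDr leq_add //.
  apply: leq_trans (count_le_sum (a := fst) (A := mem (leaves T r)) _) _.
    by apply/allP => f /es_leaf lf; apply/implyP.
  apply: (@leq_trans (\sum_(u in leaves T r) 7 * k ^ 3)); last by rewrite sum_nat_const mulnC.
  apply: leq_sum => u _; apply: leq_trans (level_dead T r es u k'k) _.
  rewrite (expnS k 2); have : k.-1 * k ^ 2 <= k * k ^ 2 by rewrite leq_mul2r leq_pred orbT.
  by rewrite mulnCA; move: (k.-1 * k ^ 2) (k * k ^ 2) => a b; lia.
apply: leq_trans (count_le_sum (a := snd) (A := predT) _) _.
  by apply/allP => f _; apply/implyP.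
apply: (@leq_trans (\sum_(w : 'I_m) 7 * k ^ 3)); last by rewrite sum_nat_const card_ord mulnC.
apply: leq_sum => w _; apply: (@leq_trans (slack k k.-1)).
  apply: leq_trans (level_promoted T r ues r w k'k); rewrite leq_eqVlt; apply/orP; left.
  apply/eqP/eq_in_count => f fes /=; rewrite (anc_to_root conn symT) ?eqxx //.
  by rewrite (leaf_depth _ (es_leaf f fes)); lia.
rewrite /slack (expnS k 2) -mulnA [k ^ 2 * _]mulnC.
have : k.-1 * k ^ 2 <= k * k ^ 2 by rewrite leq_mul2r leq_pred orbT.
have : 0 < k * k ^ 2 by rewrite -expnS expn_gt0; lia.
by move: (k.-1 * k ^ 2) (k * k ^ 2) => a b; lia.
Qed.

Import GRing.Theory Num.Theory.

(* The lower bound on #|X| is false for h = k: for k = 2, take a spider with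
   legs of length 2 and let F be a dense graph without 4-cycles. *)
Theorem theorem9p4 :
  exists A : nat, forall k : nat, (2 <= k)%N ->
  exists (P : cmd) (q D : nat),
  forall (n m h : nat) (T : rel 'I_n) (r : 'I_n)
         (F : {set 'I_n * 'I_m}) (es : seq ('I_n * 'I_m)),
    tree T ->
    height T r = h -> (h <= k)%N ->
    (forall v, v \in leaves T r -> dist T r v = h) ->
    (m <= n)%N ->
    (forall u w, (u, w) \in F -> u \in leaves T r) ->
    perm_eq es (enum F) ->
  exists (t : nat) (o : seq nat)
         (X : {set ('I_n * 'I_m) * {set {set vtx n m}}}),
    [/\ runs q P (encode_input T r es) t o,
        encodes_output (unionG T F) (2 * k) X o,
        (t <= D * (#|F| * up_log 2 n + n))%N,
        (forall f C, (f, C) \in X ->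
           [/\ f \in F, is_cycle (unionG T F) (2 * k) C & edge_of f \in C]) &
        ((h < k)%N ->
         #|F|%:R / k%:R - A%:R * k%:R ^+ 2 * (#|leaves T r| + m)%:R
           <= #|X|%:R :> rat)%R].
Proof.
exists 7 => k k2; pose K := slack k k + 2 * k.
pose CB := slack k k + 10 * k ^ 2 + 10.
exists (program k), (CB + 6), (2 * time_bound K (program k)).
move=> n m h T r F es [symT _ conn _] _ _ leaf_depth mn F_leaf esF.
have ues : uniq es by rewrite (perm_uniq esF) enum_uniq.
have es_mem : es =i F by move=> f; rewrite (perm_mem esF) mem_enum.
have sF : size es = #|F| by rewrite (perm_size esF) cardE.
have n0 : 0 < n := leq_ltn_trans (leq0n r) (ltn_ord r).
set inp := encode_input T r es.
set w := (CB + 6) * up_log 2 (size inp).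
have word_size : CB * ((n + size inp) * (n + size inp) * (n + size inp)) <= 2 ^ w.
  have Np : 4 < size inp by rewrite size_input; lia.
  have nN : n + size inp <= size inp ^ 2.
    rewrite -mulnn; have : n <= size inp by rewrite size_input; lia.
    by move: (size inp) Np => a; nia.
  apply: (@leq_trans (size inp ^ (CB + 6))); last first.
    by rewrite /w mulnC expnM leq_exp2r ?up_logP // addn_gt0 orbT.
  rewrite expnD leq_mul //; first by apply: ltnW; apply: ltn_expl; lia.
  by rewrite -[6]/(2 + 2 + 2) !expnD !leq_mul.
have K0 : 0 < K by rewrite /K; lia.
have K_large j i : j < k -> thr k j i <= K.
  move=> jk; have := slack_mono k (ltnW jk); rewrite /K.
  by case: i => [|i] /=; lia.
have [t [s [ex t_le [xs [gxs uxs xsE oE]]]]] : wp w K (size es).+1 (program k) (fun s =>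
    exists xs : seq (('I_n * 'I_m) * seq (vtx n m)),
    [/\ forall x, x \in xs -> good_cycle T k F x, uniq [seq x.1 | x <- xs],
        [seq x.1 | x <- xs] =i [seq f <- es | level T r k es k.-1 f < k.-1]
      & out s = flatten [seq code_pair x | x <- xs]]) (initial inp).
  rewrite size_input in word_size.
  apply: (wp_program mn word_size K0 ues symT conn leaf_depth F_leaf es_mem K_large k2).
  by move=> s xs *; exists xs.
pose ys := [seq (x.1, cycle_edges x.2) | x <- xs].
have fst_ys : [seq y.1 | y <- ys] = [seq x.1 | x <- xs] by rewrite -map_comp.
have uys : uniq ys by apply: (@map_uniq _ _ fst); rewrite fst_ys.
exists t, (out s), [set y in ys]; split.
- by exists s.
- exists xs; split=> //; first by move=> x /gxs[].
  by apply: uniq_perm; rewrite ?enum_uniq // => y; rewrite mem_enum inE.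
- apply: leq_trans t_le _; rewrite mulnAC leq_mul2r.
  apply/orP; right; rewrite sF.
  have [n1|n1] := leqP n 1; last first.
    have : 0 < up_log 2 n by rewrite up_log_gt0.
    by move: (up_log 2 n) => a a0; nia.
  have : #|F| <= n * m by apply: leq_trans (max_card _) _; rewrite card_prod !card_ord.
  by nia.
- move=> f C; rewrite inE => /mapP[x xxs [-> ->]].
  have [sx cx ex1] := gxs _ xxs; split=> //; last by exists x.2.
  have : x.1 \in [seq y.1 | y <- xs] by apply: map_f.
  by rewrite xsE mem_filter => /andP[_]; rewrite es_mem.
move=> hk.
have cX : #|[set y in ys]| = count (fun f => level T r k es k.-1 f < k.-1) es.
  rewrite cardsE (card_uniqP uys) -(size_map fst) fst_ys -size_filter.
  by apply/perm_size/uniq_perm; rewrite ?filter_uniq.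
have es_leaf f : f \in es -> f.1 \in leaves T r.
  by rewrite es_mem; case: f => u x /F_leaf.
have := loss_bound symT conn leaf_depth es_leaf ues k2 hk; rewrite -cX sF.
move: (#|_|) (#|_|) (_ + m) => a b c le.
have kpos : (0 < k%:R :> rat)%R by rewrite ltr0n; lia.
rewrite lerBlDr ler_pdivrMr // -natrX -!natrM -natrD -natrM ler_nat.
apply: leq_trans le _; rewrite mulnDl leq_add //; first by rewrite leq_pmulr //; lia.
by rewrite expnSr; lia.
Qed.
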